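(* Let $M\subset S^{n+1}$ be a closed, connected and strictly convex hypersurface, let $\tilde M$ be its image under the Gauss map, and let $\hat M$ and $\hat{\tilde M}$ be the convex bodies of $M$ and $\tilde M$. Then $$M^*=\tilde M\qquad\text{and}\qquad\hat M^*=\hat{\tilde M}.$$
   Context: $S^{n+1}$ is the unit sphere in $\mathbb R^{n+2}$ with Euclidean scalar product $\langle\cdot,\cdot\rangle$. A closed connected hypersurface $M\subset S^{n+1}$ is strictly convex if its second fundamental form with respect to the interior normal is positive definite; then $M$ is embedded, contained in an open hemisphere, and is the boundary of a (closed) convex body $\hat M\subset S^{n+1}$, called the convex body of $M$. The Gauss map of $M$ assigns to $x\in M$ the exterior unit normal $\tilde x=\nu\in T_x(S^{n+1})\subset\mathbb R^{n+2}$ of $M$ at $x$, regarded as a point of $S^{n+1}$; its image $\tilde M$ is again a closed, connected, strictly convex hypersurface. The polar set of $M$ is $M^*=\{y\in S^{n+1}:\sup_{x\in M}\langle x,y\rangle=0\}$, and the polar of the convex body $\hat M$ is $\hat M^*=\{y\in S^{n+1}:\sup_{x\in\hat M}\langle x,y\rangle\le 0\}$. *)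

(* Defs.v *)
From HB Require Import structures.
From mathcomp Require Import all_boot all_order all_algebra.
From mathcomp Require Import all_classical all_reals all_analysis.

Set Implicit Arguments.
Unset Strict Implicit.
Unset Printing Implicit Defensive.

Import Order.TTheory GRing.Theory Num.Theory.
Import numFieldNormedType.Exports.

Local Open Scope classical_set_scope.
Local Open Scope ring_scope.

(* 'rV[R]_n carries the max norm in the library; it is used here only for the
   topology and differentiability, the metric being given by [dot]. *)
Definition dot (R : realType) (n : nat) (x y : 'rV[R]_n) : R :=
  \sum_(i < n) x 0 i * y 0 i.

(* S^{n+1}, in R^{n+2}. *)
Definition sphere (R : realType) (n : nat) : set 'rV[R]_n.+2 :=
  [set x | dot x x = 1].
Arguments sphere : clear implicits.

Definition C1_on (R : realType) (n : nat) (U : set 'rV[R]_n.+2)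
    (f : 'rV[R]_n.+2 -> R) : Prop :=
  forall y, U y ->
    differentiable f y /\
    forall v, {for y, continuous (fun z => 'D_v f z)}.

Definition C2_on (R : realType) (n : nat) (U : set 'rV[R]_n.+2)
    (f : 'rV[R]_n.+2 -> R) : Prop :=
  C1_on U f /\ forall v, C1_on U (fun z => 'D_v f z).

(* Embedded C^2 hypersurface of the sphere: near each of its points, M is the
   zero set in the sphere of a C^2 function whose differential does not vanish
   on the tangent spaces of the sphere at points of M. *)
Definition is_hypersurface (R : realType) (n : nat) (M : set 'rV[R]_n.+2)
    : Prop :=
  M `<=` sphere R n /\
  forall x, M x ->
    exists (U : set 'rV[R]_n.+2) (f : 'rV[R]_n.+2 -> R),
      [/\ open U, U x, C2_on U f,
          M `&` U = [set y | [/\ sphere R n y, U y & f y = 0]] &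
          forall y, M y -> U y -> exists v, dot y v = 0 /\ 'D_v f y <> 0].

(* T_x M, as the velocities at x of curves in M. *)
Definition tangent (R : realType) (n : nat) (M : set 'rV[R]_n.+2)
    (x : 'rV[R]_n.+2) : set 'rV[R]_n.+2 :=
  [set v | exists g : R -> 'rV[R]_n.+2,
     [/\ g 0 = x, \forall t \near (0 : R), M (g t) &
         is_derive (0 : R) (1 : R) g v]].

(* Unit normals nu of M in the sphere at x that point into A and whose opposite
   points out of A; [t |-> cos t *: x + sin t *: nu] is the geodesic of the
   sphere starting at x with velocity nu. *)
Definition unit_normal_into (R : realType) (n : nat) (M A : set 'rV[R]_n.+2)
    (x nu : 'rV[R]_n.+2) : Prop :=
  [/\ dot nu nu = 1, dot x nu = 0,
      forall v, tangent M x v -> dot v nu = 0 &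
      \forall t \near 0^'+, A (cos t *: x + sin t *: nu) /\
                            ~ A (cos t *: x - sin t *: nu)].

(* The Weingarten form of the second fundamental form at x with respect to the
   unit normal field N.  N is defined on the ambient space, but for v tangent
   to M its derivative only depends on the restriction of N to M. *)
Definition second_ff (R : realType) (n : nat)
    (N : 'rV[R]_n.+2 -> 'rV[R]_n.+2) (x v w : 'rV[R]_n.+2) : R :=
  - dot ('D_v N x) w.

(* The interior of M is taken to be a connected component Omega of the
   complement of M in the sphere, and N is the normal pointing into it. *)
Definition strictly_convex (R : realType) (n : nat) (M : set 'rV[R]_n.+2)
    : Prop :=
  exists2 p, (sphere R n `\` M) p &
  let Omega := connected_component (sphere R n `\` M) p in
  forall x, M x ->
    exists N : 'rV[R]_n.+2 -> 'rV[R]_n.+2,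
      [/\ differentiable N x,
          \forall y \near x, M y -> unit_normal_into M Omega y (N y) &
          forall v, tangent M x v -> v <> 0 -> 0 < second_ff N x v v].

(* With z = s *: x + t *: y normalized, z runs through the minimizing geodesic
   from x to y, if y <> - x; antipodal points impose no condition. *)
Definition sphere_convex (R : realType) (n : nat) (K : set 'rV[R]_n.+2)
    : Prop :=
  forall x y s t, K x -> K y -> 0 <= s -> 0 <= t ->
    sphere R n (s *: x + t *: y) -> K (s *: x + t *: y).

(* Topological boundary relative to the sphere. *)
Definition sphere_boundary (R : realType) (n : nat) (K : set 'rV[R]_n.+2)
    : set 'rV[R]_n.+2 :=
  closure K `&` closure (sphere R n `\` K).

Definition is_convex_body (R : realType) (n : nat) (K : set 'rV[R]_n.+2)
    : Prop :=
  [/\ K `<=` sphere R n, closed K, sphere_convex K &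
      K `\` sphere_boundary K !=set0].

(* The convex body with boundary M (set0 if there is none). *)
Definition convex_body (R : realType) (n : nat) (M : set 'rV[R]_n.+2)
    : set 'rV[R]_n.+2 :=
  xget set0 [set K | is_convex_body K /\ sphere_boundary K = M].

Definition exterior_normal (R : realType) (n : nat) (M : set 'rV[R]_n.+2)
    (x nu : 'rV[R]_n.+2) : Prop :=
  unit_normal_into M (sphere R n `\` convex_body M) x nu.

Definition gauss_image (R : realType) (n : nat) (M : set 'rV[R]_n.+2)
    : set 'rV[R]_n.+2 :=
  [set nu | exists2 x, M x & exterior_normal M x nu].

Definition polar (R : realType) (n : nat) (M : set 'rV[R]_n.+2)
    : set 'rV[R]_n.+2 :=
  [set y | sphere R n y /\ sup [set dot x y | x in M] = 0].

Definition body_polar (R : realType) (n : nat) (K : set 'rV[R]_n.+2)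
    : set 'rV[R]_n.+2 :=
  [set y | sphere R n y /\ sup [set dot x y | x in K] <= 0].

(* Main.v *)
Require Import Defs.
From mathcomp Require Import all_boot all_order all_algebra.
From mathcomp Require Import all_classical all_reals all_analysis.
From mathcomp Require Import ring lra.

Import Order.TTheory GRing.Theory Num.Theory.
Import numFieldNormedType.Exports.

Local Open Scope classical_set_scope.
Local Open Scope ring_scope.

Set Implicit Arguments.
Unset Strict Implicit.
Unset Printing Implicit Defensive.

(* Work in the cone over the sphere, where geodesics become segments. Let Omega
   be the interior of M. Differentiating the proportionality of the normal field
   and of the gradient of a local defining function shows that, by positivity of
   the second fundamental form, no segment centred at a point z of M stays in the
   cone over Omega `|` M unless it is radial. Hence, for x in Omega, the set of
   points y of Omega such that the geodesic from x to y lies in Omega is both open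
   and closed in Omega minus the antipode of x, which is connected because n > 0.
   So Omega is convex, and K = Omega `|` M is a convex body with boundary M,
   contained in the half space {<., N> >= 0} for each inner normal N, with contact
   only at the base point of N. The maximum over M of <., y> for y in M^* is
   reached at some x in M, which forces y = - N(x); conversely supporting
   hyperplanes give points of M^*. The boundary of the polar of K is M^*, and a
   convex body L is determined by its boundary as soon as some segment between two
   boundary points meets its interior: both K and its polar have this property. *)

(** * Scalar product and differential calculus *)

(** The recurrent obstacle is the antipode. [sphere_convex] says nothing about a pair x, -x, and a
    segment between two points of a cone may run through 0, where it no longer projects to the
    sphere. Hence the rays excluded by [off_ray], and the separate proof that no point of M has its
    antipode in the body. Local defining functions are extended homogeneously of degree 0. They can
    then be evaluated on straight lines, and their radial derivative vanishes; the price is that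
    positivity of the second fundamental form controls a direction only up to its radial part. Since
    [convex_body] is a choice among all bodies with the given boundary, computing it is a uniqueness
    question, and uniqueness can fail: a great sphere bounds two hemispheres. For the Gauss image
    the candidate is the polar of K, whose convexity and boundary are read off from the scalar
    product, so no differential calculus on [gauss_image M] is involved. *)

Section Dot.
Variables (R : realType) (n : nat).
Implicit Types x y z v : 'rV[R]_n.

Lemma dotC x y : dot x y = dot y x.
Proof. by apply: eq_bigr => i _; rewrite mulrC. Qed.

Lemma dotDl x y z : dot (x + y) z = dot x z + dot y z.
Proof. by rewrite /dot -big_split; apply: eq_bigr => i _; rewrite mxE mulrDl. Qed.

Lemma dotZl a x z : dot (a *: x) z = a * dot x z.
Proof. by rewrite /dot mulr_sumr; apply: eq_bigr => i _; rewrite mxE mulrA. Qed.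

Lemma dotDr x y z : dot z (x + y) = dot z x + dot z y.
Proof. by rewrite dotC dotDl !(dotC z). Qed.

Lemma dotZr a x z : dot z (a *: x) = a * dot z x.
Proof. by rewrite dotC dotZl (dotC z). Qed.

Lemma dotNl x z : dot (- x) z = - dot x z.
Proof. by rewrite -scaleN1r dotZl mulN1r. Qed.

Lemma dotNr x z : dot z (- x) = - dot z x.
Proof. by rewrite -scaleN1r dotZr mulN1r. Qed.

Lemma dotBl x y z : dot (x - y) z = dot x z - dot y z.
Proof. by rewrite dotDl dotNl. Qed.

Lemma dotBr x y z : dot z (x - y) = dot z x - dot z y.
Proof. by rewrite dotDr dotNr. Qed.

Lemma dot0l z : dot 0 z = 0.
Proof. by rewrite -(scale0r z) dotZl mul0r. Qed.

Lemma dot0r z : dot z 0 = 0.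
Proof. by rewrite dotC dot0l. Qed.

Definition dotE := (dotDl, dotDr, dotZl, dotZr, dotNl, dotNr, dot0l, dot0r).

Lemma dot_ge0 x : 0 <= dot x x.
Proof. by apply: sumr_ge0 => i _; rewrite -expr2 sqr_ge0. Qed.

Lemma dot_eq0 x : (dot x x == 0) = (x == 0).
Proof.
apply/eqP/eqP => [|->]; last by rewrite dot0l.
move/eqP; rewrite psumr_eq0 => [/allP h|i _]; last by rewrite -expr2 sqr_ge0.
apply/rowP => i; rewrite mxE; apply/eqP.
by have := h i (mem_index_enum _); rewrite /= mulf_eq0 orbb.
Qed.

Lemma dot_gt0 x : (0 < dot x x) = (x != 0).
Proof. by rewrite lt_def dot_ge0 dot_eq0 andbT. Qed.

Lemma dot_delta x i : dot x (delta_mx 0 i) = x 0 i.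
Proof.
rewrite /dot (bigD1 i) //= big1 => [|j ji]; rewrite !mxE eqxx ?eqxx /=.
  by rewrite addr0 mulr1.
by rewrite (negbTE ji) mulr0.
Qed.

Lemma differentiable_dotr (W : normedModType R) (f g : W -> 'rV[R]_n) (a : W) :
  differentiable f a -> differentiable g a ->
  differentiable (fun p => dot (f p) (g p)) a.
Proof.
move=> df dg; rewrite (_ : (fun _ => _) =
   \sum_(i < n) (fun p => f p 0 i * g p 0 i)); last first.
  by apply/funext => p; rewrite fct_sumE.
apply: differentiable_sum => i; apply: differentiableM.
  by apply: (@differentiable_comp _ _ _ _ f (fun M : 'rV[R]_n => M 0 i)) => //;
     exact: differentiable_coord.
by apply: (@differentiable_comp _ _ _ _ g (fun M : 'rV[R]_n => M 0 i)) => //;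
   exact: differentiable_coord.
Qed.

Lemma dot_continuous z : continuous (fun x => dot x z).
Proof.
move=> x; apply: differentiable_continuous.
by apply: (@differentiable_dotr _ id (cst z)).
Qed.

End Dot.

Section CalculusScale.
Variables (R : realType) (V W : normedModType R).

Lemma is_derive_scale (k : V -> R) (f : V -> W) x v dk df :
  is_derive x v k dk -> is_derive x v f df ->
  is_derive x v (fun y => k y *: f y) (k x *: df + dk *: f x).
Proof.
move=> dkx dfx.
have dc : (fun h => h^-1 *: (((fun y => k y *: f y) \o shift x) (h *: v)
      - k x *: f x)) @ 0^' --> k x *: df + dk *: f x.
  rewrite (_ : (fun _ => _) = (fun h : R =>
     k (h *: v + x) *: (h^-1 *: ((f \o shift x) (h *: v) - f x)) +
     (h^-1 *: ((k \o shift x) (h *: v) - k x)) *: f x)); last first.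
    apply/funext => h /=.
    rewrite -[h^-1 *: (k _ - _)]/(h^-1 * (k (h *: v + x) - k x)).
    rewrite scalerA (mulrC (k _)) -!scalerA -scalerDr.
    by congr (_ *: _); rewrite scalerBr scalerBl addrA subrK.
  apply: cvgD.
    apply: cvgZ.
      suff : {for 0, continuous (fun h : R => k (h *: v + x))}.
        by move=> /continuous_withinNx; rewrite scale0r add0r.
      apply/differentiable_continuous/derivable1_diffP/(derivable1P _ _ _).1.
      by case: dkx.
    by have [h1 <-] := dfx; exact: h1.
  by apply: cvgZr_tmp; have [h1 <-] := dkx; exact: h1.
apply: DeriveDef; last exact: cvg_lim dc.
by apply/cvg_ex; eexists; exact: dc.
Qed.

End CalculusScale.

Section CalculusComp.
Variables (R : realType) (V W : normedModType R).

Lemma is_derive_comp (c : R -> V) (f : V -> W) (t : R) w :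
  is_derive t (1 : R) c w -> differentiable f (c t) ->
  is_derive t (1 : R) (fun s => f (c s)) ('D_w f (c t)).
Proof.
move=> [dc cw] df.
have dc' : differentiable c t by exact/derivable1_diffP.
have dfc : differentiable (f \o c) t by exact: differentiable_comp.
apply: DeriveDef; first exact/derivable1_diffP.
have e : 'd c t 1 = w by rewrite -cw deriveE.
by rewrite !deriveE // diff_comp //= e.
Qed.

Lemma is_derive_line x v (t : R) : is_derive t (1 : R) (fun s : R => x + s *: v : V) v.
Proof.
have := is_derive_scale (is_derive_id t (1 : R)) (is_derive_cst v t (1 : R)).
rewrite scaler0 add0r scale1r => h.
have := is_deriveD (is_derive_cst x t (1 : R)) h.
by rewrite add0r.
Qed.

Lemma derive_linD (f : V -> W) x u v : differentiable f x ->
  'D_(u + v) f x = 'D_u f x + 'D_v f x.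
Proof. by move=> df; rewrite !deriveE // linearD. Qed.

Lemma derive_linZ (f : V -> W) x a v : differentiable f x ->
  'D_(a *: v) f x = a *: 'D_v f x.
Proof. by move=> df; rewrite !deriveE // linearZ. Qed.

End CalculusComp.

Section RowCalculus.
Variables (R : realType) (n : nat) (V : normedModType R).

Lemma differentiable_scale (k : V -> R) (f : V -> 'rV[R]_n) x :
  differentiable k x -> differentiable f x ->
  differentiable (fun y => k y *: f y) x.
Proof.
move=> dk df; rewrite (_ : (fun _ => _) = \sum_(i < n)
   (fun y => (k y * f y 0 i) *: delta_mx 0 i)); last first.
  apply/funext => y; rewrite fct_sumE {1}[f y]row_sum_delta scaler_sumr.
  by apply: eq_bigr => i _; rewrite scalerA.
apply: differentiable_sum => i; apply: differentiableZl.
apply: differentiableM => //.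
by apply: (@differentiable_comp _ _ _ _ f (fun M : 'rV[R]_n => M 0 i)) => //;
   exact: differentiable_coord.
Qed.

Lemma is_derive_dot (f g : V -> 'rV[R]_n) x v df dg :
  is_derive x v f df -> is_derive x v g dg ->
  is_derive x v (fun y => dot (f y) (g y)) (dot (f x) dg + dot (g x) df).
Proof.
move=> fx gx.
have co (h : V -> 'rV[R]_n) dh : is_derive x v h dh ->
    forall i, is_derive x v (fun y => h y 0 i) (dh 0 i).
  move=> [h1 h2] i; apply: DeriveDef; first exact: (derivable_mxP _ _ _).1.
  by rewrite -h2 derive_mx // mxE.
have -> : (fun y => dot (f y) (g y)) = \sum_(i < n)
    ((fun y => f y 0 i) * (fun y => g y 0 i)).
  by apply/funext => y; rewrite fct_sumE.
rewrite /dot -big_split /=; apply: is_derive_sum => i.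
exact: (is_deriveM (co _ _ fx i) (co _ _ gx i)).
Qed.

End RowCalculus.

(** * Radial projection to the Euclidean unit sphere *)

Section Normalization.
Variables (R : realType) (n : nat).
Implicit Types x y z v : 'rV[R]_n.

Definition inv_norm v : R := (Num.sqrt (dot v v))^-1.

Definition nrm v := inv_norm v *: v.

Lemma inv_norm_gt0 v : v != 0 -> 0 < inv_norm v.
Proof. by move=> v0; rewrite invr_gt0 sqrtr_gt0 dot_gt0. Qed.

Lemma inv_normZ r v : 0 < r -> inv_norm (r *: v) = r^-1 * inv_norm v.
Proof.
move=> r0; rewrite /inv_norm dotZl dotZr mulrA -expr2 sqrtrM ?sqr_ge0 //.
by rewrite sqrtr_sqr gtr0_norm // invfM.
Qed.

Lemma nrmZ r v : 0 < r -> nrm (r *: v) = nrm v.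
Proof.
move=> r0; rewrite /nrm inv_normZ // scalerA mulrAC mulVf ?mul1r //.
by rewrite gt_eqF.
Qed.

Lemma dot_nrm v : v != 0 -> dot (nrm v) (nrm v) = 1.
Proof.
move=> v0; rewrite dotZl dotZr mulrA -invfM -expr2 sqr_sqrtr ?dot_ge0 //.
by rewrite mulVf // dot_eq0.
Qed.

Lemma inv_norm1 v : dot v v = 1 -> inv_norm v = 1.
Proof. by rewrite /inv_norm => ->; rewrite sqrtr1 invr1. Qed.

Lemma nrm_id v : dot v v = 1 -> nrm v = v.
Proof. by move=> v1; rewrite /nrm inv_norm1 // scale1r. Qed.

Lemma unit_neq0 v : dot v v = 1 -> v != 0.
Proof. by move=> v1; rewrite -dot_gt0 v1. Qed.

Lemma nrm_neq0 v : v != 0 -> nrm v != 0.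
Proof. by move=> v0; apply: unit_neq0; exact: dot_nrm. Qed.

Lemma nrmK v : v != 0 -> v = (inv_norm v)^-1 *: nrm v.
Proof.
by move=> v0; rewrite /nrm scalerA mulVf ?scale1r // gt_eqF // inv_norm_gt0.
Qed.

Lemma differentiable_inv_norm y : y != 0 -> differentiable inv_norm y.
Proof.
move=> y0; have d0 : 0 < dot y y by rewrite dot_gt0.
apply: differentiableV; last by rewrite gt_eqF // sqrtr_gt0.
apply: (@differentiable_comp _ _ _ _ (fun x => dot x x) Num.sqrt).
  exact: differentiable_dotr.
by apply/derivable1_diffP; case: (is_derive1_sqrt d0).
Qed.

(** Once differentiability is known, the value comes from differentiating the constant
    [inv_norm c ^+ 2 * dot c c = 1] along the line c through y and solving for the derivative of
    [inv_norm]. *)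
Lemma is_derive_inv_norm y v : y != 0 ->
  is_derive y v inv_norm (- (inv_norm y ^+ 3 * dot y v)).
Proof.
move=> y0; have d0 : 0 < dot y y by rewrite dot_gt0.
have d4 := differentiable_inv_norm y0.
apply: DeriveDef; first exact: diff_derivable.
pose c (s : R) := y + s *: v.
have c0 : c 0 = y by rewrite /c scale0r addr0.
have dc : is_derive (0 : R) (1 : R) c v by exact: is_derive_line.
have h1 : is_derive (0 : R) (1 : R) (fun s => inv_norm (c s)) ('D_v inv_norm y).
  by rewrite -[in 'D_v _ y]c0; apply: is_derive_comp; rewrite ?c0.
have h2 : is_derive (0 : R) (1 : R) (fun s => dot (c s) (c s)) (2 * dot y v).
  have := is_derive_dot dc dc; rewrite c0 => h.
  by refine (is_derive_eq h _); rewrite mulr2n mulrDl mul1r.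
have h3 : is_derive (0 : R) (1 : R) (fun s => inv_norm (c s) ^+ 2 * dot (c s) (c s))
   (inv_norm y ^+ 2 * (2 * dot y v) + dot y y * (2 * inv_norm y * 'D_v inv_norm y)).
  have := is_deriveM (is_deriveX 2 h1) h2; rewrite !c0 => h.
  refine (is_derive_eq h _); rewrite /GRing.scale /=.
  rewrite -[(_ ^+ 2) 0]/(inv_norm (c 0) ^+ 2) c0.
  by congr (_ + _); rewrite expr1.
have h4 : is_derive (0 : R) (1 : R) (fun s => inv_norm (c s) ^+ 2 * dot (c s) (c s)) 0.
  apply: near_eq_is_derive (is_derive_cst (1 : R) (0 : R) (1 : R)).
  have cc : {for 0, continuous c}.
    by apply: differentiable_continuous; apply/derivable1_diffP; case: dc.
  have : \forall s \near (0 : R), c s != 0.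
    by apply: (cvgr_neq0 _ cc); rewrite c0.
  apply: filterS => s s0'; rewrite /cst /inv_norm exprVn sqr_sqrtr ?dot_ge0 //.
  by rewrite mulVf // dot_eq0.
have e : dot y y = (inv_norm y ^+ 2)^-1.
  by rewrite /inv_norm exprVn invrK sqr_sqrtr ?dot_ge0.
have r0 : inv_norm y != 0 by rewrite gt_eqF // inv_norm_gt0.
have : inv_norm y ^+ 2 * (2 * dot y v) + dot y y * (2 * inv_norm y * 'D_v inv_norm y) = 0.
  by case: h3 => _ <-; case: h4.
rewrite e => h.
have : inv_norm y ^+ 3 * dot y v + 'D_v inv_norm y = inv_norm y / 2 *
  (inv_norm y ^+ 2 * (2 * dot y v) +
   (inv_norm y ^+ 2)^-1 * (2 * inv_norm y * 'D_v inv_norm y)) by field.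
by rewrite h mulr0 => /eqP; rewrite addrC addr_eq0 => /eqP.
Qed.

Lemma differentiable_nrm y : y != 0 -> differentiable nrm y.
Proof.
by move=> y0; apply: differentiable_scale => //; exact: differentiable_inv_norm.
Qed.

Lemma nrm_continuous y : y != 0 -> {for y, continuous nrm}.
Proof. by move=> y0; apply/differentiable_continuous/differentiable_nrm. Qed.

Lemma is_derive_nrm y v : y != 0 -> is_derive y v nrm
  (inv_norm y *: v - (inv_norm y ^+ 3 * dot y v) *: y).
Proof.
move=> y0; have := is_derive_scale (is_derive_inv_norm v y0) (is_derive_id y v).
by rewrite scaleNr.
Qed.

Lemma sum_dot_delta y : y = \sum_(i < n) dot y (delta_mx 0 i) *: delta_mx 0 i.
Proof.
by rewrite [LHS]row_sum_delta; apply: eq_bigr => i _; rewrite dot_delta.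
Qed.

Lemma dot_inj x y : (forall v, dot x v = dot y v) -> x = y.
Proof.
by move=> h; apply/eqP; rewrite -subr_eq0 -dot_eq0 dotBl h subrr.
Qed.

Section Homogenization.
Variable f : 'rV[R]_n -> R.

(** The sum is the derivative of f at [nrm y] in the direction y, expanded in the standard basis.
    With fixed directions the right-hand side can be differentiated again in y, because [C2_on]
    speaks of derivatives in fixed directions. *)
Lemma derive_nrm y v : y != 0 -> differentiable f (nrm y) ->
  'D_v (f \o nrm) y =
  inv_norm y * 'D_v f (nrm y) -
  inv_norm y ^+ 3 * dot y v * \sum_(i < n) dot y (delta_mx 0 i) * 'D_(delta_mx 0 i) f (nrm y).
Proof.
move=> y0 df; have dn := differentiable_nrm y0.
rewrite deriveE; last exact: differentiable_comp.
rewrite diff_comp //= -[in 'd nrm _ _]deriveE //.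
have [_ ->] := is_derive_nrm v y0; rewrite -deriveE // derive_linD //.
rewrite -scaleNr !derive_linZ // scaleNr; congr (_ - _ * _).
rewrite [X in 'D_X f _](sum_dot_delta y) deriveE // linear_sum /=.
by apply: eq_bigr => i _; rewrite linearZ /= -deriveE.
Qed.

End Homogenization.

End Normalization.

Arguments inv_norm {R n} v.
Arguments nrm {R n} v.

(** Two linear conditions on a space of dimension n + 2 > 2. This is how [0 < n] enters the
    geometry. *)
Lemma exists_orth (R : realType) (n : nat) (a b : 'rV[R]_n.+2) : (0 < n)%N ->
  exists v, [/\ v != 0, dot a v = 0 & dot b v = 0].
Proof.
move=> n0; pose A := row_mx a^T b^T : 'M[R]_(n.+2, 1 + 1).
have : kermx A != 0.
  rewrite kermx_eq0 /row_free; apply: contraTN (rank_leq_col A) => /eqP ->.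
  by rewrite -ltnNge !ltnS.
case/rowV0Pn => v /sub_kermxP; rewrite mul_mx_row => /eqP.
rewrite row_mx_eq0 => /andP[/eqP va /eqP vb] v0; exists v.
have dE c : v *m c^T = 0 -> dot c v = 0.
  move=> h; have := congr1 (fun A : 'M[R]_(1, 1) => A 0 0) h; rewrite !mxE => <-.
  by apply: eq_bigr => i _; rewrite mxE mulrC.
by split=> //; exact: dE.
Qed.

Lemma near_ball (R : realType) (V : normedModType R) (x : V) (P : set V) :
  (\forall y \near x, P y) <->
  exists2 e : R, 0 < e & forall y, `|y - x| < e -> P y.
Proof.
split=> [/nbhs_ballP[e /= e0 h]|[e e0 h]].
  exists e => // y ye; apply: h; rewrite -ball_normE /=.
  by rewrite distrC.
apply/nbhs_ballP; exists e => //= y; rewrite -ball_normE /= => ye.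
by apply: h; rewrite distrC.
Qed.

Lemma near_neq0 (R : realType) (V : normedModType R) (x : V) :
  x != 0 -> \forall y \near x, y != 0.
Proof.
by move=> x0; apply: (@cvgr_neq0 _ _ _ (nbhs x) _ id x) => //; exact: cvg_id.
Qed.

Lemma near0_ball (R : realType) (P : set R) :
  (\forall t \near (0 : R), P t) <->
  exists2 e : R, 0 < e & forall t, `|t| < e -> P t.
Proof.
split=> [/near_ball[e e0 h]|[e e0 h]].
  by exists e => // t te; apply: h; rewrite subr0.
by apply/near_ball; exists e => // t; rewrite subr0; exact: h.
Qed.

Lemma near0_line (R : realType) (V : normedModType R) (x v : V) (P : set V) :
  (\forall y \near x, P y) -> \forall t \near (0 : R), P (x + t *: v).
Proof.
move=> xP; have [dc _] := is_derive_line x v (0 : R).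
have : {for 0, continuous (fun t : R => x + t *: v)}.
  by apply: differentiable_continuous; apply/derivable1_diffP.
by apply; rewrite /= scale0r addr0.
Qed.

Lemma near_pos (R : realType) (P : set R) : (\forall t \near (0 : R), 0 < t -> P t) ->
  exists2 t, 0 < t & P t.
Proof.
move=> /near0_ball[e e0 h]; exists (e / 2); first by rewrite divr_gt0.
by apply: h; rewrite ?divr_gt0 // gtr0_norm ?divr_gt0 //; lra.
Qed.

(** * Sign lemmas and curves in level sets *)

Section RealSigns.
Variable R : realType.
Implicit Types u : R -> R.

Lemma derive_pos_sign u d : is_derive (0 : R) (1 : R) u d -> u 0 = 0 -> 0 < d ->
  \forall t \near (0 : R), (0 < t -> 0 < u t) /\ (t < 0 -> u t < 0).
Proof.
move=> [du ud] u0 d0.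
have h : \forall t \near (0 : R), t != 0 -> 0 < t^-1 *: (u (t *: 1 + 0) - u 0).
  by apply: (cvgr_gt _ du); rewrite -[lim _]/('D_1 u 0) ud.
apply: filterS h => t h.
have {}h : t != 0 -> 0 < t^-1 * u t.
  by move=> /h; rewrite /GRing.scale /= mulr1 addr0 u0 subr0.
split=> t0.
  by have := h (lt0r_neq0 t0); rewrite pmulr_rgt0 // invr_gt0.
by have := h (ltr0_neq0 t0); rewrite nmulr_rgt0 // invr_lt0.
Qed.

Lemma derive_ge0_right u d : is_derive (0 : R) (1 : R) u d -> u 0 = 0 ->
  (\forall t \near (0 : R), 0 < t -> 0 <= u t) -> 0 <= d.
Proof.
move=> du u0 /near0_ball[e e0 u_ge0]; rewrite leNgt; apply/negP => d0.
have Nu0 : (- u) 0 = 0 by rewrite -[LHS]/(- u 0) u0 oppr0.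
have d0' : 0 < - d by rewrite oppr_gt0.
have /near0_ball[e' e'0 u_lt0] := derive_pos_sign (is_deriveN du) Nu0 d0'.
pose t := Num.min e e' / 2.
have m0 : 0 < Num.min e e' by rewrite lt_min e0.
have t0 : 0 < t by rewrite divr_gt0.
have tm : `|t| < Num.min e e' by rewrite gtr0_norm // ltr_pdivrMr // mulr2n mulrDr mulr1 ltrDl.
move: tm; rewrite lt_min => /andP[/u_ge0 /(_ t0) h1 /u_lt0 [/(_ t0) + _]].
by rewrite -[(- u) t]/(- u t) oppr_gt0 ltNge h1.
Qed.

(** If d were negative, u1 would be negative just to the right of 0, and so would u by the mean
    value theorem. *)
Lemma derive2_ge0 u u1 d :
  (\forall t \near (0 : R), is_derive t (1 : R) u (u1 t)) ->
  is_derive (0 : R) (1 : R) u1 d -> u 0 = 0 -> u1 0 = 0 ->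
  (\forall t \near (0 : R), 0 < t -> 0 <= u t) -> 0 <= d.
Proof.
move=> /near0_ball[r r0 du] du1 u0 u10 /near0_ball[e e0 u_ge0].
rewrite leNgt; apply/negP => d0.
have Nu0 : (- u1) 0 = 0 by rewrite -[LHS]/(- u1 0) u10 oppr0.
have d0' : 0 < - d by rewrite oppr_gt0.
have /near0_ball[e' e'0 u_lt0] := derive_pos_sign (is_deriveN du1) Nu0 d0'.
pose m := Num.min r (Num.min e e'); pose t := m / 2.
have m0 : 0 < m by rewrite !lt_min r0 e0.
have t0 : 0 < t by rewrite divr_gt0.
have tm : t < m by rewrite ltr_pdivrMr // mulr2n mulrDr mulr1 ltrDl.
have sm s : 0 <= s <= t -> [/\ `|s| < r, `|s| < e & `|s| < e'].
  case/andP=> s0 /le_lt_trans/(_ tm); rewrite !lt_min ger0_norm //.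
  by case/and3P.
have [] := @MVT R u u1 0 t t0.
- move=> s; rewrite in_itv /= => /andP[s0 st].
  by apply: du; have [] := sm s _; rewrite ?(ltW s0) ?(ltW st).
- apply: derivable_within_continuous => s; rewrite in_itv /= => st.
  by have [/du[]] := sm s st.
move=> s; rewrite in_itv /= => /andP[s0 st].
rewrite u0 !subr0 => ut.
have [|_ _ /u_lt0[/(_ s0) + _]] := sm s; first by rewrite (ltW s0) (ltW st).
have [|_ /u_ge0 /(_ t0) + _] := sm t; first by rewrite (ltW t0) lexx.
rewrite ut pmulr_lge0 // -[(- u1) s]/(- u1 s) oppr_gt0.
by move=> h1 /lt_le_trans/(_ h1); rewrite ltxx.
Qed.

End RealSigns.

Section ImplicitCurve.
Variables (R : realType) (V : normedModType R).
Variables (U : set V) (F : V -> R) (y v m : V).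
Hypotheses (openU : open U) (Uy : U y).
Hypothesis dF : forall z, U z -> differentiable F z.
Hypotheses (Fy : F y = 0) (vF : 'D_v F y = 0) (mF : 0 < 'D_m F y).

Let sol (t s : R) := F (y + t *: v + s *: m) = 0.

(** The intermediate value theorem stands in for the implicit function theorem. As ['D_v F y = 0], F
    has slopes e 'D_m F y and - e 'D_m F y along the lines through y of directions v + e m and v - e
    m, hence opposite signs on them, and it vanishes in between. The zero need not be unique. *)
Lemma implicit_small (e : R) : 0 < e ->
  \forall t \near (0 : R), exists2 s, `|s| <= e * `|t| & sol t s.
Proof.
move=> e0.
have yU : \forall z \near y, U z by exact: open_nbhs_nbhs.
have [r r0 rU] := (near_ball _ _).1 yU.
have sgn (a : R) : is_derive (0 : R) (1 : R)
    (fun t => F (y + t *: (v + a *: m))) (a * 'D_m F y).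
  have dl := is_derive_line y (v + a *: m) (0 : R).
  have y0 : y + (0 : R) *: (v + a *: m) = y by rewrite scale0r addr0.
  have := is_derive_comp dl; rewrite y0 => /(_ _ _ (dF Uy)).
  by rewrite derive_linD ?derive_linZ ?vF ?add0r //; exact: dF.
have F0 a : F (y + (0 : R) *: (v + a *: m)) = 0 by rewrite scale0r addr0.
have p1 := derive_pos_sign (sgn e) (F0 e) (mulr_gt0 e0 mF).
have p2 : \forall t \near (0 : R), (0 < t -> F (y + t *: (v + (- e) *: m)) < 0) /\
     (t < 0 -> 0 < F (y + t *: (v + (- e) *: m))).
  have Nd0 : 0 < - (- e * 'D_m F y) by rewrite mulNr opprK mulr_gt0.
  have Nu0 : (- (fun t : R => F (y + t *: (v + (- e) *: m)))) 0 = 0.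
    by rewrite -[LHS]/(- F _) F0 oppr0.
  apply: filterS (derive_pos_sign (is_deriveN (sgn (- e))) Nu0 Nd0) => t;
    rewrite -[(- _) t]/(- F _) oppr_gt0 oppr_lt0.
  by [].
have [d d0 hd] : exists2 d : R, 0 < d & forall t, `|t| < d ->
    forall s, `|s| <= e * `|t| -> U (y + t *: v + s *: m).
  pose c := `|v| + e * `|m| + 1.
  have c0 : 0 < c by rewrite ltr_wpDl // addr_ge0 // mulr_ge0 // ltW.
  exists (r / c) => [|t td s st]; first by rewrite divr_gt0.
  apply: rU; rewrite -[y + _ + _]addrA [y + _]addrC addrK.
  apply: le_lt_trans (ler_normD _ _) _; rewrite !normrZ.
  apply: (@le_lt_trans _ _ (`|t| * c)); last by rewrite -ltr_pdivlMr.
  apply: (@le_trans _ _ (`|t| * `|v| + (e * `|t|) * `|m|)).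
    by rewrite lerD2l ler_wpM2r.
  by rewrite /c !mulrDr mulr1 mulrA (mulrC e) lerDl.
have p3 : \forall t \near (0 : R), forall s, `|s| <= e * `|t| ->
    U (y + t *: v + s *: m) by apply/near0_ball; exists d.
apply: filterS3 p1 p2 p3 => t [a1 a2] [b1 b2] tU.
pose phi s := F (y + t *: v + s *: m).
have [t0|t0|t0] := ltrgtP t 0; last first.
- exists 0; first by rewrite normr0 mulr_ge0 // ltW.
  by rewrite /sol t0 !scale0r !addr0.
- have et : 0 < e * t by rewrite mulr_gt0.
  have le_et : - (e * t) <= e * t by rewrite -subr_ge0 opprK addr_ge0 // ltW.
  have [|||s] := @IVT R phi (- (e * t)) (e * t) 0.
  + exact: le_et.
  + apply: derivable_within_continuous => s; rewrite in_itv /= -ler_norml => se.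
    have Us : U (y + t *: v + s *: m) by apply: tU; rewrite (gtr0_norm t0).
    have dl := is_derive_line (y + t *: v) m (s : R).
    by have [] := is_derive_comp dl (dF Us).
  + have -> : phi (e * t) = F (y + t *: (v + e *: m)).
      by rewrite /phi scalerDr scalerA addrA (mulrC e).
    have -> : phi (- (e * t)) = F (y + t *: (v + (- e) *: m)).
      by rewrite /phi scalerDr scalerA addrA mulrN (mulrC e).
    by rewrite ge_min le_max (ltW (b1 t0)) (ltW (a1 t0)) orbT.
  rewrite in_itv /= -ler_norml => se s0; exists s => //.
  by rewrite (gtr0_norm t0).
have et : e * t < 0 by rewrite nmulr_llt0.
have le_et : e * t <= - (e * t) by rewrite -subr_ge0 addr_ge0 // oppr_ge0 ltW.
have [|||s] := @IVT R phi (e * t) (- (e * t)) 0.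
- exact: le_et.
- apply: derivable_within_continuous => s.
  rewrite in_itv /= -[X in X <= s]opprK -ler_norml => se.
  have Us : U (y + t *: v + s *: m) by apply: tU; rewrite (ltr0_norm t0) mulrN.
  have dl := is_derive_line (y + t *: v) m (s : R).
  by have [] := is_derive_comp dl (dF Us).
- have -> : phi (e * t) = F (y + t *: (v + e *: m)).
    by rewrite /phi scalerDr scalerA addrA (mulrC e).
  have -> : phi (- (e * t)) = F (y + t *: (v + (- e) *: m)).
    by rewrite /phi scalerDr scalerA addrA mulrN (mulrC e).
  by rewrite ge_min le_max (ltW (b2 t0)) (ltW (a2 t0)) orbT.
rewrite in_itv /= -[X in X <= s]opprK -ler_norml => se s0; exists s => //.
by rewrite (ltr0_norm t0) mulrN.
Qed.

(* The solution [s t] is chosen of nearly minimal size, so that the same [s]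
   satisfies the bound of [implicit_small] for every [e]. *)
Lemma implicit_curve : exists s : R -> R,
  [/\ s 0 = 0, is_derive (0 : R) (1 : R) s 0 &
      \forall t \near (0 : R), F (y + t *: v + s t *: m) = 0].
Proof.
(* The infimum of the sizes of solutions is only approached; the slack t ^+ 2 is o(t), so it does
   not affect the derivative at 0. *)
have near_min t : t != 0 -> (exists s, sol t s) ->
    exists s, sol t s /\ forall s', sol t s' -> `|s| <= `|s'| + t ^+ 2.
  move=> t0 [s1 s1t]; pose E := [set `|s| | s in sol t].
  have hE : has_inf E.
    split; first by exists `|s1|, s1.
    by exists 0 => _ [s _ <-].
  have t2 : 0 < t ^+ 2 by rewrite exprn_even_gt0.
  have [_ [s st <-] sE] := inf_adherent t2 hE.
  exists s; split=> // s' s't; apply/ltW/(lt_le_trans sE).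
  by rewrite lerD2r; apply: ge_inf; [case: hE|exists s'].
pose s t := if t == 0 then 0 else
  xget 0 [set s | sol t s /\ forall s', sol t s' -> `|s| <= `|s'| + t ^+ 2].
have s0 : s 0 = 0 by rewrite /s eqxx.
have sP t : t != 0 -> (exists s, sol t s) ->
    sol t (s t) /\ forall s', sol t s' -> `|s t| <= `|s'| + t ^+ 2.
  move=> t0 /(near_min t t0) h; rewrite /s (negbTE t0).
  exact: (xgetPex 0 h).
exists s; split=> //.
- have dc : (fun h : R => h^-1 *: ((s \o shift (0 : R)) (h *: (1 : R)) - s 0))
      @ 0^' --> (0 : R).
    apply/cvgr0Pnorm_lt => e e0.
    have e2 : 0 < e / 2 by rewrite divr_gt0.
    have h1 := implicit_small e2.
    have h2 : \forall t \near (0 : R), `|t| < e / 2.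
      by apply/near0_ball; exists (e / 2).
    have : \forall t \near (0 : R), t != 0 ->
      `|t^-1 *: ((s \o shift (0 : R)) (t *: (1 : R)) - s 0)| < e; last by [].
    apply: filterS2 h1 h2 => t [s1 s1t sol1] te t0.
    rewrite s0 subr0 /= addr0 [t *: _]mulr1 normrZ normfV mulrC.
    rewrite ltr_pdivrMr ?normr_gt0 //.
    have [_ /(_ s1 sol1) h] := sP t t0 (ex_intro _ s1 sol1).
    apply: le_lt_trans h _; apply: (@le_lt_trans _ _ (e / 2 * `|t| + `|t| ^+ 2)).
      by rewrite real_normK ?num_real // lerD2r.
    rewrite {2}(splitr e) mulrDl ltrD2l expr2 ltr_pM2r //.
    by rewrite normr_gt0.
  apply: DeriveDef; last exact: cvg_lim dc.
  by apply/cvg_ex; eexists; exact: dc.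
- apply: filterS (implicit_small ltr01) => t [s1 _ sol1].
  have [->|t0] := eqVneq t 0; first by rewrite s0 !scale0r !addr0.
  by have [] := sP t t0 (ex_intro _ s1 sol1).
Qed.

End ImplicitCurve.

(** * Defining functions of a hypersurface *)

(** The difference g - f vanishes near x, so it has differential zero with no remainder. *)
Lemma near_eq_differentiable (R : realType) (V W : normedModType R)
    (f g : V -> W) (x : V) :
  (\forall y \near x, f y = g y) -> differentiable f x -> differentiable g x.
Proof.
move=> fg df; have -> : g = f + (g - f) by rewrite addrC subrK.
apply: differentiableD => //.
have e : (g - f) \o shift x = cst ((g - f) x) + \0 +o_ 0 id.
  apply/eqaddoP => _/posnumP[e]; near=> h.
  rewrite /= -[X in `|X|]/((g - f) (h + x) - ((g - f) x + 0)) addr0.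
  rewrite -![(g - f) _]/(g _ - f _).
  rewrite (nbhs_singleton fg) subrr subr0.
  suff -> : f (h + x) = g (h + x) by rewrite subrr normr0.
  near: h; have /near_ball[r r0 H] := fg.
  by apply/near_ball; exists r => // h; rewrite subr0 => hr; apply: H; rewrite addrK.
have d : 'd (g - f) x = \0 :> (V -> W).
  by apply/diff_unique => //; exact: cst_continuous.
by apply/diff_locallyP; split; [rewrite d; exact: cst_continuous | rewrite d].
Unshelve. all: by end_near. Qed.

(* A defining function of the cone over [M], homogeneous of degree 0. *)
Record defining_function (R : realType) (n : nat) (M U : set 'rV[R]_n)
    (F : 'rV[R]_n -> R) : Prop := DefiningFunction {
  df_open : open U;
  df_neq0 : forall y, U y -> y != 0;
  df_diff : forall y, U y -> differentiable F y;
  df_diff2 : forall v y, U y -> differentiable (fun z => 'D_v F z) y;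
  df_zero : forall y, U y -> M (nrm y) <-> F y = 0;
  df_radial : forall y, U y -> 'D_y F y = 0;
  df_regular : forall y, U y -> F y = 0 -> exists v, 'D_v F y != 0
}.

(** Composing the given local equation with [nrm] makes it constant on rays, and [derive_nrm] shows
    that it remains twice differentiable. *)
Lemma hypersurface_defining (R : realType) (n : nat) (M : set 'rV[R]_n.+2) x :
  is_hypersurface M -> M x ->
  exists U F, U x /\ defining_function M U F.
Proof.
move=> [MS /(_ x) h] Mx; have {h} [U [f [oU Ux [df1 df2] Mf reg]]] := h Mx.
pose U' := [set y : 'rV[R]_n.+2 | y != 0 /\ U (nrm y)].
have sx : dot x x = 1 by exact: MS.
exists U', (f \o nrm); split.
  by split; [exact: unit_neq0|rewrite nrm_id].
have oU' : open U'.
  rewrite openE => y [y0 Uy]; rewrite /interior.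
  have h1 := near_neq0 y0.
  have h2 : \forall z \near y, U (nrm z).
    by apply: (nrm_continuous y0); exact: open_nbhs_nbhs.
  by apply: filterS2 h1 h2 => z.
have dF y v : U' y -> 'D_v (f \o nrm) y = inv_norm y * 'D_v f (nrm y) -
    inv_norm y ^+ 3 * dot y v *
    \sum_(i < n.+2) dot y (delta_mx 0 i) * 'D_(delta_mx 0 i) f (nrm y).
  by move=> [y0 Uy]; apply: derive_nrm => //; exact: (df1 _ Uy).1.
split=> //.
- by move=> y [].
- move=> y [y0 Uy]; apply: differentiable_comp; first exact: differentiable_nrm.
  exact: (df1 _ Uy).1.
- move=> v y U'y; have [y0 Uy] := U'y.
  have yU' : \forall z \near y, U' z by exact: open_nbhs_nbhs.
  apply: (@near_eq_differentiable _ _ _ (fun z => inv_norm z * 'D_v f (nrm z) -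
    inv_norm z ^+ 3 * dot z v *
    \sum_(i < n.+2) dot z (delta_mx 0 i) * 'D_(delta_mx 0 i) f (nrm z))).
    by apply: filterS yU' => z U'z; rewrite dF.
  have di := differentiable_inv_norm y0.
  have dd w : differentiable (fun z => 'D_w f (nrm z)) y.
    apply: (@differentiable_comp _ _ _ _ nrm (fun z => 'D_w f z)).
      exact: differentiable_nrm.
    exact: (df2 w _ Uy).1.
  apply: differentiableB; first by apply: differentiableM.
  apply: differentiableM.
    apply: differentiableM; first exact: (differentiableX 2 di).
    exact: differentiable_dotr.
  rewrite (_ : (fun _ => _) = \sum_(i < n.+2) (fun z =>
    dot z (delta_mx 0 i) * 'D_(delta_mx 0 i) f (nrm z))); last first.
    by apply/funext => z; rewrite fct_sumE.
  apply: differentiable_sum => i; apply: differentiableM => //.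
  exact: differentiable_dotr.
- move=> y [y0 Uy]; have e : (M `&` U) (nrm y) <-> f (nrm y) = 0.
    rewrite Mf; split=> [[]//|fy]; split=> //; exact: dot_nrm.
  by rewrite /= -e; split=> [My|[]//]; split.
- move=> y U'y; have [y0 Uy] := U'y.
  pose c (s : R) := y + s *: y.
  have c0 : c 0 = y by rewrite /c scale0r addr0.
  have := is_derive_comp (is_derive_line y y (0 : R)); rewrite scale0r addr0.
  move=> /(_ _ (f \o nrm)) []; first by
    apply: differentiable_comp; [exact: differentiable_nrm|exact: (df1 _ Uy).1].
  move=> _ <-.
  have h : \forall s \near (0 : R), (f \o nrm) y = (f \o nrm) (y + s *: y).
    apply/near0_ball; exists 1 => // s s1 /=.
    rewrite -[X in _ = f (nrm (X + _))]scale1r -scalerDl nrmZ //.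
    by rewrite -ltrBlDl sub0r; move: s1; rewrite ltr_norml => /andP[].
  by have [] := near_eq_is_derive h (is_derive_cst ((f \o nrm) y) (0 : R) (1 : R)).
- move=> y U'y Fy; have [y0 Uy] := U'y.
  have My : M (nrm y).
    have : [set z | [/\ sphere R n z, U z & f z = 0]] (nrm y).
      by split=> //; exact: dot_nrm.
    by rewrite -Mf => -[].
  have [v [yv Dv]] := reg _ My Uy; exists v.
  (* The direction given by regularity is tangent to the sphere, so the radial correction in
     [derive_nrm] disappears. *)
  have {}yv : dot y v = 0 by rewrite (nrmK y0) dotZl yv mulr0.
  rewrite dF // yv mulr0 mul0r subr0; apply: mulf_neq0.
    by rewrite gt_eqF // inv_norm_gt0.
  by apply/eqP.
Qed.

Section DefiningFunction.
Variables (R : realType) (n : nat) (M U : set 'rV[R]_n.+2).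
Variable F : 'rV[R]_n.+2 -> R.
Hypotheses (dF : defining_function M U F) (MS : M `<=` sphere R n).
Implicit Types y v a b nu : 'rV[R]_n.+2.

(** Used to orient F so that it increases along the inner normal, and to exchange the two sides of
    M. *)
Lemma defining_functionN : defining_function M U (- F).
Proof.
have D v y : U y -> 'D_v (- F) y = - 'D_v F y.
  by move=> Uy; apply: deriveN; apply/diff_derivable/(df_diff dF).
split.
- exact: df_open dF.
- exact: df_neq0 dF.
- by move=> y Uy; apply/differentiableN/(df_diff dF).
- move=> v y Uy; apply: (@near_eq_differentiable _ _ _ (- (fun z => 'D_v F z))).
    have : \forall z \near y, U z by apply: open_nbhs_nbhs; split=> //;
      exact: df_open dF.
    by apply: filterS => z Uz; rewrite D.
  exact/differentiableN/(df_diff2 dF).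
- move=> y Uy; rewrite (df_zero dF Uy) -[(- F) y]/(- F y).
  by split=> [->|/eqP]; rewrite ?oppr0 // oppr_eq0 => /eqP.
- by move=> y Uy; rewrite D // (df_radial dF) // oppr0.
- move=> y Uy /eqP; rewrite -[(- F) y]/(- F y) oppr_eq0 => /eqP Fy.
  by have [v Dv] := df_regular dF Uy Fy; exists v; rewrite D // oppr_eq0.
Qed.

Lemma defining_M y : U y -> M y -> F y = 0.
Proof. by move=> Uy My; apply/(df_zero dF Uy); rewrite nrm_id //; exact: MS. Qed.

(** [implicit_curve] gives a curve in the zero set of F, that is, in the cone over M. Normalizing
    brings it to M and keeps its velocity, because y is a unit vector orthogonal to v. *)
Lemma kernel_curve y v : U y -> M y -> dot y v = 0 -> 'D_v F y = 0 ->
  exists g : R -> 'rV[R]_n.+2, [/\ g 0 = y,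
    \forall t \near (0 : R), M (g t) & is_derive (0 : R) (1 : R) g v].
Proof.
move=> Uy My yv Dv; have Fy := defining_M Uy My.
have y1 : dot y y = 1 by exact: MS.
have [m mF] : exists m, 0 < 'D_m F y.
  have [m] := df_regular dF Uy Fy; rewrite neq_lt => /orP[m0|m0]; last by exists m.
  exists (- m); rewrite -scaleN1r derive_linZ; last exact: df_diff dF _ Uy.
  by rewrite scaleN1r oppr_gt0.
have [s [s0 ds sF]] := implicit_curve (df_open dF) Uy (df_diff dF) Fy Dv mF.
pose G t := y + t *: v + s t *: m.
have G0 : G 0 = y by rewrite /G s0 !scale0r !addr0.
have dG : is_derive (0 : R) (1 : R) G v.
  have h := is_deriveD (is_derive_line y v (0 : R))
    (is_derive_scale ds (is_derive_cst m (0 : R) (1 : R))).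
  by apply: (is_derive_eq h); rewrite scaler0 scale0r !addr0.
have y0 := unit_neq0 y1.
exists (nrm \o G); split.
- by rewrite /= G0 nrm_id.
- have UG : \forall t \near (0 : R), U (G t).
    have : {for 0, continuous G}.
      by apply: differentiable_continuous; apply/derivable1_diffP; case: dG.
    by apply; rewrite G0; apply: open_nbhs_nbhs; split=> //; exact: df_open dF.
  by apply: filterS2 UG sF => t Ut Ft; apply/(df_zero dF Ut).
- have := is_derive_comp dG; rewrite G0 => /(_ _ nrm (differentiable_nrm y0)).
  have [_ ->] := is_derive_nrm v y0.
  by rewrite yv mulr0 scale0r subr0 inv_norm1 // scale1r.
Qed.

Lemma kernel_tangent y v : U y -> M y -> dot y v = 0 -> 'D_v F y = 0 ->
  tangent M y v.
Proof. exact: kernel_curve. Qed.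

(* Proportionality to the gradient of [F], cross-multiplied so that along [M] it
   can be differentiated without normalizing the gradient. *)
Lemma normal_parallel y nu : U y -> M y -> dot y nu = 0 ->
  (forall v, tangent M y v -> dot v nu = 0) ->
  forall a b, dot nu a * 'D_b F y = dot nu b * 'D_a F y.
Proof.
move=> Uy My ynu tnu a b; have dFy := df_diff dF Uy.
have y1 : dot y y = 1 by exact: MS.
pose w := 'D_b F y *: a - 'D_a F y *: b.
have Dw : 'D_w F y = 0.
  rewrite derive_linD // -scaleNr !derive_linZ // /GRing.scale /=.
  by rewrite mulNr mulrC subrr.
(* w is in the kernel of the differential of F; without its radial part it is tangent to the sphere,
   and still in the kernel by [df_radial]. *)
have : dot (w - dot y w *: y) nu = 0.
  apply: tnu; apply: kernel_tangent => //.
    by rewrite !dotE y1 mulr1 subrr.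
  rewrite derive_linD // -scaleNr derive_linZ // Dw (df_radial dF) //.
  by rewrite scaler0 addr0.
rewrite dotBl dotZl ynu mulr0 subr0 !dotE => /eqP.
by rewrite subr_eq0 !(dotC nu) mulrC => /eqP ->; rewrite mulrC.
Qed.

Lemma normal_gradient y nu : U y -> M y -> dot nu nu = 1 -> dot y nu = 0 ->
  (forall v, tangent M y v -> dot v nu = 0) ->
  'D_nu F y != 0 /\ forall b, 'D_b F y = dot nu b * 'D_nu F y.
Proof.
move=> Uy My nu1 ynu tnu; have P := normal_parallel Uy My ynu tnu.
have E b : 'D_b F y = dot nu b * 'D_nu F y by rewrite -P nu1 mul1r.
split=> //; apply/eqP => D0.
have [v] := df_regular dF Uy (defining_M Uy My).
by rewrite E D0 mulr0 eqxx.
Qed.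

End DefiningFunction.

Definition cone (R : realType) (n : nat) (A : set 'rV[R]_n) : set 'rV[R]_n :=
  [set v | v != 0 /\ A (nrm v)].

(** * Cones and the sides of a hypersurface *)

Section Segments.
Variables (R : realType) (V : normedModType R).
Implicit Types (a b z : V) (t : R).

Lemma segE a b t : a + t *: (b - a) = (1 - t) *: a + t *: b.
Proof. by rewrite scalerBr scalerBl scale1r addrA addrAC. Qed.

Lemma seg_ball a b z t (r : R) : 0 <= t <= 1 -> `|a - z| < r -> `|b - z| < r ->
  `|a + t *: (b - a) - z| < r.
Proof.
move=> /andP[t0 t1] ar br.
have -> : a + t *: (b - a) - z = (1 - t) *: (a - z) + t *: (b - z).
  rewrite segE !scalerBr addrACA -opprD -scalerDl subrK scale1r.
  by [].
apply: (le_lt_trans (ler_normD _ _)); rewrite !normrZ.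
rewrite (ger0_norm t0) ger0_norm ?subr_ge0 //.
have [->|tn0] := eqVneq t 0; first by rewrite subr0 mul1r mul0r addr0.
have tp : 0 < t by rewrite lt_def tn0.
have : t * `|b - z| < t * r by rewrite ltr_pM2l.
have : (1 - t) * `|a - z| <= (1 - t) * r by rewrite ler_wpM2l ?subr_ge0 // ltW.
lra.
Qed.

End Segments.

Lemma closed_sphere (R : realType) (n : nat) : closed (sphere R n).
Proof.
rewrite (_ : sphere R n = (fun x : 'rV[R]_n.+2 => dot x x) @^-1` [set 1]) //.
apply: closed_comp => [z _|]; last exact: closed_eq.
by apply: differentiable_continuous; apply: differentiable_dotr.
Qed.

Section Component.
Variables (R : realType) (n : nat) (M : set 'rV[R]_n.+2) (p : 'rV[R]_n.+2).
Hypotheses (M_hyp : is_hypersurface M) (M_compact : compact M).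
Let Omega := connected_component (sphere R n `\` M) p.
Let CO := cone Omega.
Implicit Types a b v x y z nu : 'rV[R]_n.+2.

Let MS : M `<=` sphere R n. Proof. by case: M_hyp. Qed.

Lemma component_notM x : Omega x -> dot x x = 1 /\ ~ M x.
Proof. by move=> /connected_component_sub [? ?]. Qed.

Lemma component_cone x : Omega x -> CO x.
Proof.
move=> Ox; have [x1 _] := component_notM Ox.
by split; [exact: unit_neq0|rewrite nrm_id].
Qed.

Lemma cone_component x : dot x x = 1 -> CO x -> Omega x.
Proof. by move=> x1 [_]; rewrite nrm_id. Qed.

Lemma cone_notM v : CO v -> ~ M (nrm v).
Proof. by move=> [_ /component_notM[]]. Qed.

(** The projected segment is a connected subset of the sphere minus M. Membership in Omega is always
    propagated through this lemma. *)
Lemma component_seg a b : CO a ->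
  (forall t, 0 <= t <= 1 ->
     a + t *: (b - a) != 0 /\ ~ M (nrm (a + t *: (b - a)))) -> CO b.
Proof.
move=> [a0 Oa] ab.
pose c t := nrm (a + t *: (b - a)).
have cc : {within `[0, 1], continuous c}.
  apply: derivable_within_continuous => t; rewrite in_itv /= => /ab[c0 _].
  by have [] := is_derive_comp (is_derive_line a (b - a) t) (differentiable_nrm c0).
have con := connected_continuous_connected (@segment_connected R 0 1) cc.
have c0 : c 0 = nrm a by rewrite /c scale0r addr0.
have c1 : c 1 = nrm b by rewrite /c scale1r addrC subrK.
have b0 : b != 0.
  by have [|] := ab 1; rewrite ?lexx ?ler01 // scale1r addrC subrK.
split=> //; apply: (connected_component_trans Oa).
have sub : c @` `[0, 1] `<=` sphere R n `\` M.
  by move=> _ [t + <-]; rewrite /= in_itv /= => /ab[h1 h2]; split=> //; exact: dot_nrm.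
apply: (connected_component_max _ sub con).
  by exists 0; rewrite //= in_itv /= lexx ler01.
by exists 1; rewrite //= in_itv /= lexx ler01.
Qed.

Lemma component_ball v : v != 0 -> ~ M (nrm v) ->
  exists2 r : R, 0 < r & forall a b, `|a - v| < r -> `|b - v| < r -> CO a -> CO b.
Proof.
move=> v0 Mv.
have h1 := near_neq0 v0.
have h2 : \forall z \near v, ~ M (nrm z).
  have : nbhs (nrm v) (~` M); last exact: (nrm_continuous v0).
  apply: open_nbhs_nbhs; split=> //.
  apply: closed_openC; apply: compact_closed => //; exact: norm_hausdorff.
have : \forall z \near v, z != 0 /\ ~ M (nrm z) by apply: filterS2 h1 h2.
move=> /near_ball[r r0 h]; exists r => // a b ar br COa.
by apply: (component_seg COa) => t t01; apply: h; exact: seg_ball.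
Qed.

Lemma open_cone : open CO.
Proof.
rewrite openE => v COv; have [r r0 h] := component_ball COv.1 (cone_notM COv).
have : \forall y \near v, CO y; last by [].
apply/near_ball; exists r => // y yr; apply: (h v) => //.
by rewrite subrr normr0.
Qed.

Lemma closure_component x : closure Omega x -> Omega x \/ M x.
Proof.
move=> clx; have [Mx|Mx] := pselect (M x); [by right|left].
have x1 : dot x x = 1.
  by apply: closed_sphere; apply: closure_subset clx => z /component_notM[].
have x0 := unit_neq0 x1; apply: (cone_component x1).
have [|r r0 h] := component_ball x0; first by rewrite nrm_id.
have [y [Oy yr]] : (Omega `&` [set y | `|y - x| < r]) !=set0.
  by apply: clx; apply/(near_ball x [set y | `|y - x| < r]); exists r.
apply: (h y) => //; last exact: component_cone.
by rewrite subrr normr0.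
Qed.

(** The region F > 0 near z need not be convex, so a and b are not joined directly. Both are pushed
    by s0 m, along which F increases, into a small ball around z + s0 m where F > 0, and are joined
    inside that ball. *)
Lemma same_side U F z m : defining_function M U F -> U z -> F z = 0 ->
  0 < 'D_m F z ->
  exists2 r : R, 0 < r & forall a b, `|a - z| < r -> `|b - z| < r ->
    0 < F a -> 0 < F b -> CO a -> CO b.
Proof.
move=> dF Uz Fz mF.
have h1 : \forall y \near z, U y by apply: open_nbhs_nbhs; split=> //;
  exact: df_open dF.
have h2 : \forall y \near z, 0 < 'D_m F y.
  by apply: (cvgr_gt _ (differentiable_continuous (df_diff2 dF m Uz))).
have : \forall y \near z, U y /\ 0 < 'D_m F y by apply: filterS2 h1 h2.
move=> /near_ball[r1 r10 hr1].
(* A push by at most s0 m moves a point by less than r1 / 2, so points within r1 / 2 of z stay where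
   F is controlled. *)
pose s0 := r1 / 2 / (`|m| + 1).
have m1 : 0 < `|m| + 1 by rewrite ltr_wpDl.
have s00 : 0 < s0 by rewrite !divr_gt0.
have s0m s : 0 <= s <= s0 -> `|s *: m| < r1 / 2.
  move=> /andP[s_ge0 s_le]; rewrite normrZ (ger0_norm s_ge0).
  have : s * `|m| <= s0 * `|m| by rewrite ler_wpM2r.
  have : s0 * (`|m| + 1) = r1 / 2 by rewrite /s0 mulfVK // gt_eqF.
  by rewrite mulrDr mulr1 => <-; lra.
have push y s : `|y - z| < r1 / 2 -> 0 <= s <= s0 -> `|y + s *: m - z| < r1.
  move=> yr /s0m sm; rewrite addrAC; apply: (le_lt_trans (ler_normD _ _)); lra.
have incr y s : `|y - z| < r1 / 2 -> 0 <= s <= s0 -> F y <= F (y + s *: m) /\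
    (0 < s -> F y < F (y + s *: m)).
  move=> yr ss; have [s_ge0 s_le] := andP ss.
  have dl t : 0 <= t <= s -> is_derive t (1 : R) (fun t => F (y + t *: m))
     ('D_m F (y + t *: m)).
    move=> /andP[t0 ts]; apply: (is_derive_comp (is_derive_line _ _ _)).
    by apply: (df_diff dF); apply: (hr1 _ _).1; apply: push;
      rewrite // t0 (le_trans ts).
  have [s0'|] := ltP 0 s; last first.
    by move=> s_le0; have -> : s = 0 by [lra]; rewrite scale0r addr0 ltxx.
  have [||t] := @MVT R (fun t => F (y + t *: m)) (fun t => 'D_m F (y + t *: m)) 0 s s0'.
  - by move=> t; rewrite in_itv /= => /andP[t0 t1]; apply: dl; rewrite !ltW.
  - by apply: derivable_within_continuous => t; rewrite in_itv /= => /dl[].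
  rewrite in_itv /= scale0r addr0 subr0 => /andP[t0 ts] e.
  have : 0 < 'D_m F (y + t *: m).
    by apply: (hr1 _ _).2; apply: push; rewrite // (ltW t0) (le_trans (ltW ts)).
  move=> /mulr_gt0/(_ s0'); rewrite -e subr_gt0 => h.
  by split=> //; exact: ltW.
pose c := z + s0 *: m.
have zz : `|z - z| < r1 / 2 by rewrite subrr normr0 divr_gt0.
have s0s0 : 0 <= s0 <= s0 by rewrite ltW /=.
have Fc : 0 < F c by have [_ /(_ s00)] := incr z s0 zz s0s0; rewrite Fz.
have Uc : U c by apply: (hr1 _ _).1; exact: push.
have : \forall y \near c, 0 < F y.
  by apply: (cvgr_gt _ (differentiable_continuous (df_diff dF Uc))).
move=> /near_ball[r2 r20 hr2].
have noM y : U y -> 0 < F y -> y != 0 /\ ~ M (nrm y).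
  move=> Uy Fy; split; first exact: df_neq0 dF _ Uy.
  by move=> /(df_zero dF Uy) F0; rewrite F0 ltxx in Fy.
exists (Num.min (r1 / 2) r2) => [|a b]; first by rewrite lt_min r20 divr_gt0.
have half : r1 / 2 < r1 by lra.
rewrite !lt_min => /andP[ar1 ar2] /andP[br1 br2] Fa Fb COa.
have path y s : `|y - z| < r1 / 2 -> 0 < F y -> 0 <= s <= s0 ->
    y + s *: m != 0 /\ ~ M (nrm (y + s *: m)).
  move=> yr Fy ss; apply: noM; first by apply: (hr1 _ _).1; exact: push.
  by apply: (lt_le_trans Fy); have [] := incr y s yr ss.
have ts0 t : 0 <= t <= 1 -> 0 <= t * s0 <= s0.
  move=> /andP[t0 t1]; rewrite mulr_ge0 ?(ltW s00) //=.
  by rewrite ger_pMl.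
have COa' : CO (a + s0 *: m).
  apply: (component_seg COa) => t t01.
  by rewrite addrAC subrr add0r scalerA; apply: path => //; exact: ts0.
have COb' : CO (b + s0 *: m).
  apply: (component_seg COa') => t t01; apply: noM.
    by apply: (hr1 _ _).1; apply: seg_ball => //; apply: push.
  by apply: hr2; apply: seg_ball => //; rewrite /c opprD addrACA subrr addr0.
apply: (component_seg COb') => t /andP[t0 t1].
have -> : b + s0 *: m + t *: (b - (b + s0 *: m)) = b + ((1 - t) * s0) *: m.
  rewrite opprD addrA subrr add0r scalerN -addrA; congr (_ + _).
  by rewrite mulrBl mul1r scalerBl scalerA.
by apply: path => //; apply: ts0; apply/andP; split; lra.
Qed.

End Component.

(** * Local charts of the interior and the second fundamental form *)

Section InnerChart.
Variables (R : realType) (n : nat) (M : set 'rV[R]_n.+2) (p : 'rV[R]_n.+2).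
Hypotheses (M_hyp : is_hypersurface M) (M_compact : compact M).
Let Omega := connected_component (sphere R n `\` M) p.
Let CO := cone Omega.
Let K := Omega `|` M.
Implicit Types a b d v x y z nu : 'rV[R]_n.+2.

Let MS : M `<=` sphere R n. Proof. by case: M_hyp. Qed.

Lemma is_derive_geodesic x nu (t : R) :
  is_derive t (1 : R) (fun t => cos t *: x + sin t *: nu)
    (- sin t *: x + cos t *: nu).
Proof.
have h := is_deriveD (is_derive_scale (is_derive_cos t) (is_derive_cst x t (1 : R)))
  (is_derive_scale (is_derive_sin t) (is_derive_cst nu t (1 : R))).
by apply: (is_derive_eq h); rewrite !scaler0 !add0r.
Qed.

Lemma geodesic_unit x nu (t : R) : dot x x = 1 -> dot nu nu = 1 -> dot x nu = 0 ->
  dot (cos t *: x + sin t *: nu) (cos t *: x + sin t *: nu) = 1.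
Proof.
move=> x1 nu1 xnu; rewrite !dotE (dotC nu x) x1 nu1 xnu.
by rewrite !mulr0 addr0 add0r !mulr1 -!expr2 cos2Dsin2.
Qed.

Lemma near_geodesic x nu (B : set 'rV[R]_n.+2) : nbhs x B ->
  \forall t \near (0 : R), B (cos t *: x + sin t *: nu).
Proof.
move=> nB; have [dc _] := is_derive_geodesic x nu 0.
have cc : {for 0, continuous (fun t : R => cos t *: x + sin t *: nu)}.
  by apply: differentiable_continuous; apply/derivable1_diffP.
have : nbhs (cos 0 *: x + sin 0 *: nu) B by rewrite cos0 sin0 scale1r scale0r addr0.
exact: cc.
Qed.

Lemma geodesic_sign U F x nu : defining_function M U F -> U x -> M x ->
  0 < 'D_nu F x ->
  \forall t \near (0 : R), (0 < t -> 0 < F (cos t *: x + sin t *: nu)) /\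
                           (0 < t -> F (cos t *: x - sin t *: nu) < 0).
Proof.
move=> dF Ux Mx nuF.
pose c (t : R) := cos t *: x + sin t *: nu.
have c0 : c 0 = x by rewrite /c cos0 sin0 scale1r scale0r addr0.
have dc : is_derive (0 : R) (1 : R) c nu.
  apply: (is_derive_eq (is_derive_geodesic x nu 0)).
  by rewrite cos0 sin0 oppr0 scale1r scale0r add0r.
have := is_derive_comp dc; rewrite c0 => /(_ _ _ (df_diff dF Ux)) dFc.
have Fc0 : F (c 0) = 0 by rewrite c0 (defining_M dF).
have /near0_ball[e e0 h] := derive_pos_sign dFc Fc0 nuF.
apply/near0_ball; exists e => // t te; split=> t0.
  by have [/(_ t0)] := h t te.
have := h (- t); rewrite normrN oppr_lt0 => /(_ te)[_ /(_ t0)].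
by rewrite /c cosN sinN scaleNr.
Qed.

(** By [same_side] for F and for - F, one point on each side decides which side is Omega. The two
    points come from the geodesic in the definition of [unit_normal_into]. *)
Lemma inner_chart z nu : M z -> unit_normal_into M Omega z nu ->
  exists U F, [/\ U z, defining_function M U F, 0 < 'D_nu F z &
    exists2 r : R, 0 < r & forall y, `|y - z| < r -> U y /\ (CO y <-> 0 < F y)].
Proof.
move=> Mz [nu1 znu tnu side]; have z1 : dot z z = 1 by exact: MS.
have [U [F [Uz dF nuF]]] : exists U F, [/\ U z, defining_function M U F &
    0 < 'D_nu F z].
  have [U [F [Uz dF]]] := hypersurface_defining M_hyp Mz.
  have [+ _] := normal_gradient dF MS Uz Mz nu1 znu tnu.
  rewrite neq_lt => /orP[neg|pos]; last by exists U, F.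
  exists U, (- F); split=> //; first exact: defining_functionN.
  rewrite deriveN ?oppr_gt0 //; apply/diff_derivable.
  exact: df_diff dF _ Uz.
exists U, F; split=> //.
have Fz := defining_M dF MS Uz Mz.
have [r1 r10 pos] := same_side p dF Uz Fz nuF.
have nuF' : 0 < 'D_(- nu) (- F) z.
  rewrite -[- nu]scaleN1r derive_linZ; last exact/differentiableN/(df_diff dF).
  rewrite deriveN; first by rewrite /GRing.scale /= mulN1r opprK.
  exact/diff_derivable/(df_diff dF).
have Fz' : (- F) z = 0 by rewrite -[LHS]/(- F z) Fz oppr0.
have [r2 r20 neg] := same_side p (defining_functionN dF) Uz Fz' nuF'.
have : \forall y \near z, U y by apply: open_nbhs_nbhs; split=> //; exact: df_open dF.
move=> /near_ball[r3 r30 rU].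
pose r := Num.min r1 (Num.min r2 r3).
have r0 : 0 < r by rewrite !lt_min r10 r20.
have /near0_ball[e1 e10 sgn] := geodesic_sign dF Uz Mz nuF.
have [e2 e20 sd] : exists2 e : R, 0 < e & forall t, 0 < t -> t < e ->
   Omega (cos t *: z + sin t *: nu) /\ ~ Omega (cos t *: z - sin t *: nu).
  move: side; rewrite /at_right /within /= => /near0_ball[e e0 h].
  by exists e => // t t0 te; apply: h; rewrite ?gtr0_norm.
have clo nu' : \forall t \near (0 : R), `|cos t *: z + sin t *: nu' - z| < r.
  apply: (near_geodesic nu' (B := [set y | `|y - z| < r])).
  by apply/(near_ball z [set y | `|y - z| < r]); exists r.
have : \forall t \near (0 : R), `|cos t *: z + sin t *: nu - z| < r /\
    `|cos t *: z - sin t *: nu - z| < r.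
  apply: filterS2 (clo nu) (clo (- nu)) => t h1 h2.
  by rewrite scalerN in h2.
move=> /near0_ball[e3 e30 cl].
pose m := Num.min e1 (Num.min e2 e3).
have m0 : 0 < m by rewrite !lt_min e10 e20.
pose t := m / 2.
have t0 : 0 < t by rewrite divr_gt0.
have : `|t| < m by rewrite gtr0_norm // ltr_pdivrMr // mulr2n mulrDr mulr1 ltrDl.
rewrite !lt_min => /and3P[/sgn[/(_ t0) Fp /(_ t0) Fm]].
rewrite gtr0_norm // => /(sd t t0)[Op Om]; rewrite -[X in X < e3]gtr0_norm //.
move=> /cl[]; rewrite !lt_min => /and3P[p1 p2 p3] /and3P[m1 m2 m3].
exists r => // y; rewrite !lt_min => /and3P[y1 y2 y3].
split; first exact: rU.
split=> [COy|Fy]; last exact: (pos _ _ p1 y1 Fp Fy (component_cone Op)).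
(* F y = 0 would put y over M; F y < 0 would carry Omega to the outer geodesic point. *)
rewrite ltNge; apply/negP; rewrite le_eqVlt => /orP[/eqP F0|Fn].
  by apply: (cone_notM COy); apply/(df_zero dF (rU _ y3)).
apply: Om; apply: (@cone_component _ _ M).
  rewrite -scalerN; apply: geodesic_unit => //; first by rewrite dotNl dotNr opprK.
  by rewrite dotNr znu oppr0.
by apply: (neg _ _ y2 m2 _ _ COy); rewrite -[X in 0 < X]/(- F _) oppr_gt0.
Qed.

Lemma body_chart U F y : defining_function M U F -> U y ->
  (CO y <-> 0 < F y) -> cone K y <-> 0 <= F y.
Proof.
move=> dF Uy COF; have y0 := df_neq0 dF Uy; rewrite le_eqVlt; split.
  move=> [_ [Oy|My]]; first by rewrite (COF.1 _) ?orbT.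
  by rewrite ((df_zero dF Uy).1 My) eqxx.
move=> /orP[/eqP F0|/COF[_ Oy]]; split=> //; [right|by left].
by apply/(df_zero dF Uy).
Qed.

(* Derives [<N, v> 'D_N F = <N, N> 'D_v F] along a curve of [M] with velocity
   [v]: the second derivative of [F] in the direction [v] is a negative multiple
   of [second_ff]. *)
Lemma strict_direction (N : 'rV[R]_n.+2 -> 'rV[R]_n.+2) z d :
  M z -> differentiable N z ->
  (\forall y \near z, M y -> unit_normal_into M Omega y (N y)) ->
  (forall v, tangent M z v -> v <> 0 -> 0 < second_ff N z v v) ->
  (\forall t \near (0 : R), cone K (z + t *: d)) -> d = dot z d *: z.
Proof.
move=> Mz dN NM II Kd; have z1 : dot z z = 1 by exact: MS.
have Nz : unit_normal_into M Omega z (N z) by exact: (nbhs_singleton NM).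
have [U [F [Uz dF nuF [r r0 ch]]]] := inner_chart Mz Nz.
have [N1 zN tN _] := Nz.
set k := dot z d; pose v := d - k *: z.
have zv : dot z v = 0 by rewrite !dotE z1 mulr1 subrr.
suff v0 : v = 0 by apply/eqP; rewrite -subr_eq0; apply/eqP.
apply: contrapT => v0.
have near_t (y : 'rV[R]_n.+2) : \forall t \near (0 : R), `|z + t *: y - z| < r.
  apply: (@near0_line _ _ _ _ (fun w => `|w - z| < r)).
  by apply/near_ball; exists r.
(* Replacing d by its tangential part v only rescales: z + t v is 1 - t k times z + t / (1 - t k) d,
   with a positive factor for small t. *)
have Fv : \forall t \near (0 : R), 0 <= F (z + t *: v).
  have h1 : \forall t \near (0 : R), `|t * k| < 1 / 2.
    have [q q0 hq] : exists2 q : R, 0 < q & q * `|k| <= 1 / 4.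
      exists (1 / 4 / (`|k| + 1)); first by rewrite !divr_gt0 // ltr_wpDl.
      by rewrite mulrAC ler_pdivrMr ?ltr_wpDl // ler_pM2l ?lerDl // divr_gt0.
    apply/near0_ball; exists q => // t tq; rewrite normrM.
    apply: (@le_lt_trans _ _ (q * `|k|)); first by rewrite ler_wpM2r // ltW.
    by apply: le_lt_trans hq _; lra.
  move/near0_ball: Kd => [e e0 Kd].
  have h2 : \forall t \near (0 : R), `|t| < e / 2.
    by apply/near0_ball; exists (e / 2); rewrite ?divr_gt0.
  apply: filterS3 h1 h2 (near_t v) => t tk te /ch[Ut COt].
  apply/(body_chart dF Ut COt).
  have a0 : 0 < 1 - t * k by move: tk; rewrite ltr_norml; lra.
  have a1 : 1 / 2 < 1 - t * k by move: tk; rewrite ltr_norml; lra.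
  have e1 : z + t *: v = (1 - t * k) *: (z + (t / (1 - t * k)) *: d).
    rewrite [RHS]scalerDr scalerA mulrCA divff ?gt_eqF // mulr1.
    by rewrite /v scalerBr scalerA scalerBl scale1r addrA addrAC.
  have [| w0 Kw] := Kd (t / (1 - t * k)).
    rewrite normrM normfV (gtr0_norm a0) ltr_pdivrMr //.
    apply: lt_le_trans te _; rewrite ler_pM2l //; lra.
  by rewrite e1; split; [rewrite scaler_eq0 negb_or gt_eqF|rewrite nrmZ].
have dline (y : 'rV[R]_n.+2) (t : R) : U (z + t *: y) ->
    is_derive t (1 : R) (fun t => F (z + t *: y)) ('D_y F (z + t *: y)).
  move=> Ut; apply: (is_derive_comp (is_derive_line _ _ _)).
  exact: df_diff dF _ Ut.
have Fz := defining_M dF MS Uz Mz.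
have F0 : F (z + (0 : R) *: v) = 0 by rewrite scale0r addr0.
have U0 y : U (z + (0 : R) *: y) by rewrite scale0r addr0.
have Dv_ge0 : 0 <= 'D_v F z.
  have := derive_ge0_right (dline v 0 (U0 v)) F0; rewrite scale0r addr0; apply.
  by apply: filterS Fv.
have Dv_le0 : 'D_v F z <= 0.
  have h := dline (- v) 0 (U0 (- v)).
  have F0' : F (z + (0 : R) *: - v) = 0 by rewrite scale0r addr0.
  have DN : 'D_(- v) F (z + (0 : R) *: - v) = - 'D_v F z.
    by rewrite scale0r addr0 !deriveE ?linearN //; exact: df_diff dF _ Uz.
  rewrite -oppr_ge0 -DN; apply: (derive_ge0_right h F0').
  move/near0_ball: Fv => [e e0 Fv]; apply/near0_ball; exists e => // t te _.
  by rewrite scalerN -scaleNr; apply: Fv; rewrite normrN.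
have Dv : 'D_v F z = 0 by apply/eqP; rewrite eq_le Dv_le0.
have [g [g0 Mg dg]] := kernel_curve dF MS Uz Mz zv Dv.
have tv : tangent M z v by exists g.
have nv : dot v (N z) = 0 by exact: tN.
have gU : \forall t \near (0 : R), U (g t) /\ unit_normal_into M Omega (g t) (N (g t)).
  have gc : {for 0, continuous g}.
    by apply: differentiable_continuous; apply/derivable1_diffP; case: dg.
  have h1 : \forall t \near (0 : R), U (g t).
    by apply: gc; rewrite g0; apply: open_nbhs_nbhs; split=> //; exact: df_open dF.
  have h2 : \forall t \near (0 :
    R), M (g t) -> unit_normal_into M Omega (g t) (N (g t)).
    have h : \forall y \near g 0, M y -> unit_normal_into M Omega y (N y) by rewrite g0.
    exact: (gc _ h).
  by apply: filterS3 h1 h2 Mg => t ? h /h.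
have dNg : is_derive (0 : R) (1 : R) (fun t => N (g t)) ('D_v N z).
  by rewrite -g0; apply: is_derive_comp => //; rewrite g0.
have dDg a : is_derive (0 : R) (1 : R) (fun t => 'D_a F (g t)) ('D_v (fun y =>
  'D_a F y) z).
  rewrite -[in X in is_derive _ _ _ X]g0; apply: is_derive_comp => //.
  by rewrite g0; exact: df_diff2 dF _ _ Uz.
have dd a : is_derive (0 : R) (1 : R) (fun t => dot (N (g t)) a) (dot ('D_v N z) a).
  have h := is_derive_dot dNg (is_derive_cst a (0 : R) (1 : R)).
  by apply: (is_derive_eq h); rewrite /= dot0r add0r dotC.
have P : \forall t \near (0 : R),
    ((fun t => dot (N (g t)) v) * (fun t => 'D_(N z) F (g t))) t =
    ((fun t => dot (N (g t)) (N z)) * (fun t => 'D_v F (g t))) t.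
  apply: filterS2 gU Mg => t [Ut [_ gN tg _]] Mt.
  exact: (normal_parallel dF MS Ut Mt gN tg).
have [_ e1] := near_eq_is_derive P (is_deriveM (dd v) (dDg (N z))).
have [_ e2] := is_deriveM (dd (N z)) (dDg v).
(* Since <N, v> and ['D_v F] vanish at z, the product rule leaves the second derivative of F along v
   equal to ['D_(N z) F z] times <'D_v N z, v>. *)
move: e1; rewrite e2 !g0 N1 Dv (dotC (N z) v) nv !scale0r add0r addr0 scale1r.
rewrite /GRing.scale /= => e.
have dl2 : is_derive (0 : R) (1 : R) (fun t => 'D_v F (z + t *: v))
    ('D_v (fun y => 'D_v F y) z).
  have z0 : z + (0 : R) *: v = z by rewrite scale0r addr0.
  rewrite -[in X in is_derive _ _ _ X]z0.
  apply: (is_derive_comp (is_derive_line _ _ _)).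
  by rewrite z0; exact: df_diff2 dF _ _ Uz.
have : 0 <= 'D_v (fun y => 'D_v F y) z.
  apply: (@derive2_ge0 _ (fun t => F (z + t *: v)) _ _ _ dl2 F0); first last.
  - by apply: filterS Fv.
  - by rewrite scale0r addr0.
  - by apply: filterS (near_t v) => t /ch[Ut _]; exact: dline.
have := II v tv v0; rewrite /second_ff oppr_gt0 => neg.
by rewrite e leNgt pmulr_rlt0 // neg.
Qed.

End InnerChart.

(** * From local to global convexity *)

Lemma connected_clopen (T : topologicalType) (E A : set T) :
  connected E -> E `&` A !=set0 -> open A -> E `&` closure A `<=` A -> E `<=` A.
Proof.
move=> cE EA oA cA; have <- : E `&` A = E; last by apply: subIsetr.
apply: cE => //; first by exists A.
exists (closure A); first exact: closed_closure.
rewrite eqEsubset; split=> y [Ey Ay]; split=> //; first exact: subset_closure.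
exact: cA.
Qed.

Lemma connected_seg (R : realType) (V : normedModType R) (a b : V) :
  connected [set a + t *: (b - a) | t in `[0 : R, 1]].
Proof.
apply: connected_continuous_connected; first exact: segment_connected.
apply: derivable_within_continuous => t _.
by have [] := is_derive_line a (b - a) t.
Qed.

Section Convexity.
Variables (R : realType) (n : nat) (M : set 'rV[R]_n.+2) (p : 'rV[R]_n.+2).
Hypotheses (n_gt0 : (0 < n)%N) (M_hyp : is_hypersurface M) (M_compact : compact M).
Let Omega := connected_component (sphere R n `\` M) p.
Let CO := cone Omega.
Let K := Omega `|` M.
Hypothesis strict : forall z d, M z ->
  (\forall t \near (0 : R), cone K (z + t *: d)) -> d = dot z d *: z.
Implicit Types a b v x y z : 'rV[R]_n.+2.

Let MS : M `<=` sphere R n. Proof. by case: M_hyp. Qed.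

Definition visible x : set 'rV[R]_n.+2 :=
  [set y | forall t : R, 0 <= t <= 1 -> CO (x + t *: (y - x))].

(** For x != 0, the complement of the closed ray issued from 0 in the direction - x: the points to
    which a geodesic from x can be drawn as a projected segment. *)
Definition off_ray x : set 'rV[R]_n.+2 :=
  [set y | forall t : R, 0 <= t <= 1 -> x + t *: (y - x) != 0].

Lemma visible_off_ray x : visible x `<=` off_ray x.
Proof. by move=> y h t /h[]. Qed.

(** Tube lemma: [CO] is open and the parameter interval is compact. *)
Lemma open_visible x : open (visible x).
Proof.
rewrite openE => y xy.
have : near_covering [set` `[0 : R, 1]] by apply/compact_near_coveringP;
  exact: segment_compact.
move=> /(_ _ (nbhs y) (fun y t => CO (x + t *: (y - x))) _).
have : forall t : R, [set` `[0, 1]] t ->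
  \forall t' \near t & y' \near y, CO (x + t' *: (y' - x)).
  move=> t; rewrite /= in_itv /= => /xy COt.
  have : nbhs (x + t *: (y - x)) CO.
    by apply: open_nbhs_nbhs; split=> //; exact: open_cone.
  apply: (_ : (fun q : R * 'rV[R]_n.+2 => x + q.1 *: (q.2 - x)) @ (t, y)
     --> x + t *: (y - x)).
  apply: cvgD; first exact: cvg_cst.
  apply: cvgZ; first exact: cvg_fst.
  by apply: cvgB; [exact: cvg_snd|exact: cvg_cst].
move=> h /(_ h); rewrite /interior; apply: filterS => y' xy' t t01.
by apply: xy'; rewrite /= in_itv.
Qed.

Lemma closure_visible_body x y (t : R) : closure (visible x) y ->
  0 <= t <= 1 -> x + t *: (y - x) != 0 -> K (nrm (x + t *: (y - x))).
Proof.
move=> cly t01 w0; apply: (closure_component M_compact) => B nB.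
have : \forall y' \near y, B (nrm (x + t *: (y' - x))).
  have c : {for y, continuous (fun y' => nrm (x + t *: (y' - x)))}.
    apply: (@continuous_comp _ _ _ (fun y' => x + t *: (y' - x)) nrm).
      by apply: differentiable_continuous; apply: differentiableD.
    exact: nrm_continuous.
  exact: (c _ nB).
move=> /cly[y' [xy' By']]; exists (nrm (x + t *: (y' - x))); split=> //.
by have [] := xy' t t01.
Qed.

(** The limit segment lies in the cone over K. If it met the cone over M, it would do so at an inner
    point, and [strict] would make the segment radial there. *)
Lemma closure_visible x y : Omega x -> CO y -> off_ray x y ->
  closure (visible x) y -> visible x y.
Proof.
move=> Ox COy off cly t t01; have w0 := off t t01.
set w := x + t *: (y - x).
have Kw : K (nrm w) by exact: closure_visible_body.
split=> //; case: Kw => // Mz; exfalso.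
set z := nrm w in Mz.
have [x1 nMx] := component_notM Ox; have x0 := unit_neq0 x1.
have COx := component_cone Ox.
have wz : w = (inv_norm w)^-1 *: z by exact: nrmK.
set c := (inv_norm w)^-1 in wz.
have c0 : 0 < c by rewrite invr_gt0 inv_norm_gt0.
have z0 : z != 0 by exact: nrm_neq0.
have t0 : 0 < t.
  case/andP: t01 => t0 _; rewrite lt_def t0 andbT; apply/eqP => t0'.
  by apply: nMx; rewrite -(nrm_id x1); move: Mz; rewrite /z /w t0' scale0r addr0.
have t1 : t < 1.
  case/andP: t01 => _ t1; rewrite lt_def t1 andbT eq_sym; apply/eqP => t1'.
  by apply: (cone_notM COy); move: Mz; rewrite /z /w t1' scale1r addrC subrK.
have yxz : y - x = dot z (y - x) *: z.
  apply: strict => //.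
  pose e := Num.min t (1 - t) * c^-1.
  have e0 : 0 < e by apply: mulr_gt0; [rewrite lt_min t0 subr_gt0|rewrite invr_gt0].
  apply/near0_ball; exists e => // s se.
  have st : `|s * c| < Num.min t (1 - t).
    by rewrite normrM (gtr0_norm c0) -ltr_pdivlMr.
  have st01 : 0 <= t + s * c <= 1.
    by move: st; rewrite lt_min !ltr_norml => /andP[/andP[a1 _] /andP[_ a2]];
      apply/andP; split; lra.
  have -> : z + s *: (y - x) = c^-1 *: (x + (t + s * c) *: (y - x)).
    rewrite scalerDl addrA -/w wz [RHS]scalerDr; congr (_ + _).
      by rewrite scalerK // gt_eqF.
    by rewrite scalerA mulrCA mulVf ?mulr1 // gt_eqF.
  have w'0 := off _ st01.
  split; first by rewrite scaler_eq0 negb_or invr_eq0 gt_eqF.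
  by rewrite nrmZ; [exact: closure_visible_body|rewrite invr_gt0].
set k := dot z (y - x) in yxz.
have xz : x = (c - t * k) *: z.
  by rewrite scalerBl -scalerA -yxz -wz /w addrK.
have yz : y = (c - t * k + k) *: z.
  by rewrite scalerDl -xz -yxz addrC subrK.
have nz : nrm z = z by apply: nrm_id; exact: MS.
(* x and y are now multiples of z. A positive multiple would lie over M, so both coefficients are
   nonpositive, against their convex combination being c > 0. *)
have a_le0 : c - t * k <= 0.
  rewrite leNgt; apply/negP => a0.
  by apply: (cone_notM COx); rewrite xz nrmZ // nz.
have b_le0 : c - t * k + k <= 0.
  rewrite leNgt; apply/negP => b0.
  by apply: (cone_notM COy); rewrite yz nrmZ // nz.
have h1 : (1 - t) * (c - t * k) <= 0 by rewrite pmulr_rle0 // subr_gt0.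
have h2 : t * (c - t * k + k) <= 0 by rewrite pmulr_rle0.
have : (1 - t) * (c - t * k) + t * (c - t * k + k) = c by ring.
lra.
Qed.

(** Along such a segment, visibility from x is open by [open_visible] and closed by
    [closure_visible]. *)
Lemma visible_seg x a b : Omega x -> visible x a ->
  (forall t : R, 0 <= t <= 1 ->
    CO (a + t *: (b - a)) /\ off_ray x (a + t *: (b - a))) ->
  visible x b.
Proof.
move=> Ox xa ab.
have sub : [set a + t *: (b - a) | t in `[0 : R, 1]] `<=` visible x.
  apply: connected_clopen; first exact: connected_seg.
  - exists a; split=> //; exists 0; last by rewrite scale0r addr0.
    by rewrite /= in_itv /= lexx ler01.
  - exact: open_visible.
  - move=> _ [[t + <-]]; rewrite /= in_itv /= => /ab[h1 h2].
    exact: closure_visible.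
apply: sub; exists 1; last by rewrite scale1r addrC subrK.
by rewrite /= in_itv /= lexx ler01.
Qed.

Lemma off_ray_dot x y w : x != 0 -> dot w x = 0 -> dot w y != 0 -> off_ray x y.
Proof.
move=> x0 wx wy t t01; apply/eqP => e.
have : dot w (x + t *: (y - x)) = 0 by rewrite e dot0r.
rewrite !dotE wx oppr0 addr0 add0r => /eqP; rewrite mulf_eq0 (negbTE wy) orbF.
by move=> /eqP t0; move: e; rewrite t0 scale0r addr0 => e; rewrite e eqxx in x0.
Qed.

(* Removing the ray opposite to [x] does not disconnect a ball around [- x],
   because there is room for a direction orthogonal to [x] and to [a]. *)
Lemma visible_antipode x (r : R) a b : Omega x -> 0 < r ->
  (forall y, `|y + x| < r -> CO y) ->
  `|a + x| < r -> `|b + x| < r -> visible x a -> off_ray x b -> visible x b.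
Proof.
move=> Ox r0 rCO ar br xa offb.
have [x1 _] := component_notM Ox; have x0 := unit_neq0 x1.
have [w [w0 xw aw bw]] : exists w, [/\ w != 0, dot x w = 0, dot a w = 0 & 0 <= dot b w].
  have [w [w0 xw aw]] := exists_orth x a n_gt0.
  have [bw|bw] := leP 0 (dot b w); first by exists w.
  exists (- w); rewrite oppr_eq0 !dotNr xw aw oppr0; split=> //.
  by rewrite oppr_ge0 ltW.
have ww : 0 < dot w w by rewrite dot_gt0.
pose rho := r / 2 / (`|w| + 1).
have w1 : 0 < `|w| + 1 by rewrite ltr_wpDl.
have rho0 : 0 < rho by rewrite !divr_gt0.
(* c is - x pushed along w. On the path from a to c to b the form <w, .> is positive except possibly
   at a and b, so the path meets the ray, where this form vanishes, at most at its ends; these are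
   off the ray by assumption. *)
have [c cr wc] : exists2 c, `|c + x| < r & dot w c = rho * dot w w.
  exists (- x + rho *: w); last by rewrite !dotE (dotC w) xw oppr0 add0r.
  rewrite addrC addrA subrr add0r normrZ gtr0_norm //.
  have : rho * (`|w| + 1) = r / 2 by rewrite /rho mulfVK // gt_eqF.
  rewrite mulrDr mulr1; lra.
have ball a' b' t : 0 <= t <= 1 -> `|a' + x| < r -> `|b' + x| < r ->
    CO (a' + t *: (b' - a')).
  move=> t01 a'r b'r; apply: rCO; rewrite -[x]opprK.
  by apply: seg_ball => //; rewrite opprK.
have xc : visible x c.
  apply: (visible_seg Ox xa) => t t01; split; first exact: ball.
  have [->|t0] := eqVneq t 0.
    by rewrite scale0r addr0; exact: visible_off_ray.
  apply: (@off_ray_dot _ _ w) => //; first by rewrite dotC.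
  rewrite !dotE wc (dotC w a) aw oppr0 addr0 add0r.
  by rewrite mulf_neq0 // gt_eqF // mulr_gt0.
apply: (visible_seg Ox xc) => t t01; split; first exact: ball.
have [->|t1] := eqVneq t 1; first by rewrite scale1r addrC subrK.
apply: (@off_ray_dot _ _ w) => //; first by rewrite dotC.
case/andP: t01 => t0 t1'; have {}t1 : 0 < 1 - t by rewrite subr_gt0 lt_def eq_sym t1.
have -> : dot w (c + t *: (b - c)) = (1 - t) * (rho * dot w w) + t * dot b w.
  by rewrite !dotE wc (dotC w b); ring.
by rewrite gt_eqF // ltr_wpDr ?mulr_ge0 // !mulr_gt0.
Qed.

Lemma off_rayP x y : dot x x = 1 -> dot y y = 1 -> y != - x -> off_ray x y.
Proof.
move=> x1 y1 yx t /andP[t0 t1]; apply/eqP; rewrite segE => e.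
have e' : (1 - t) *: x = - (t *: y) by apply/eqP; rewrite -addr_eq0 e.
have : dot ((1 - t) *: x) ((1 - t) *: x) = dot (t *: y) (t *: y).
  by rewrite e' dotNl dotNr opprK.
rewrite !dotZl !dotZr x1 y1 !mulr1 => h.
have th : t = 1 / 2 by nra.
have h2 : 1 - t = t by lra.
move: e; rewrite h2 -scalerDr => /eqP; rewrite scaler_eq0 [x + y]addrC addr_eq0.
rewrite (negbTE yx) orbF => /eqP t_eq0; lra.
Qed.

(** The clopen set is the closure of [visible x]: it can contain - x, so connectedness of Omega
    itself suffices, and [closure_visible] removes the closure at y. Openness at - x rests on
    [visible_antipode]. *)
Lemma component_visible x y : Omega x -> Omega y -> y != - x -> visible x y.
Proof.
move=> Ox Oy yx.
have [x1 _] := component_notM Ox; have x0 := unit_neq0 x1.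
have COx := component_cone Ox.
have oCO := open_cone (p := p) M_compact.
have clop z : Omega z -> closure (visible x) z ->
    \forall z' \near z, CO z' -> closure (visible x) z'.
  move=> Oz clz; have [z1 _] := component_notM Oz; have COz := component_cone Oz.
  have [zx|zx] := eqVneq z (- x); last first.
    have xz : visible x z by apply: closure_visible => //; exact: off_rayP.
    have : nbhs z (visible x) by apply: open_nbhs_nbhs; split=> //; exact: open_visible.
    by apply: filterS => z' xz' _; exact: subset_closure.
  have : \forall z' \near z, CO z' by apply: open_nbhs_nbhs.
  move=> /near_ball[r r0 rCO].
  have rCO' z' : `|z' + x| < r -> CO z' by rewrite -[x]opprK -zx; exact: rCO.
  have [a [xa ar]] : (visible x `&` [set a | `|a - z| < r]) !=set0.
    by apply: clz; apply/(near_ball z [set a | `|a - z| < r]); exists r.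
  have {}ar : `|a + x| < r by rewrite -[x]opprK -zx.
  apply/near_ball; exists r => // b; rewrite zx opprK => br COb.
  have [w [w0 xw _]] := exists_orth x x n_gt0.
  have [bx|bx] := pselect (off_ray x b).
    by apply: subset_closure; apply: (visible_antipode Ox r0 rCO' ar br).
  (* Here b is on the excluded ray. The points b + t w with small t > 0 are off it, hence visible,
     so b is in the closure. *)
  have bw : dot w b = 0.
    apply/eqP; apply: contrapT => /negP bw; apply: bx.
    by apply: (@off_ray_dot _ _ w) => //; rewrite dotC.
  move=> B nB.
  have brn : nbhs b [set b' | `|b' + x| < r].
    apply/(near_ball b [set b' | `|b' + x| < r]); exists (r - `|b + x|).
      by rewrite subr_gt0.
    move=> b' b'b /=; have -> : b' + x = (b' - b) + (b + x) by rewrite addrA subrK.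
    by apply: (le_lt_trans (ler_normD _ _)); lra.
  have : \forall t \near (0 : R), B (b + t *: w) /\ `|b + t *: w + x| < r.
    exact: (near0_line w (filterI nB brn)).
  move=> /near0_ball[e e0 h].
  have e2 : 0 < e / 2 by rewrite divr_gt0.
  have [|Bb bbr] := h (e / 2); first by rewrite gtr0_norm //; lra.
  exists (b + (e / 2) *: w); split=> //.
  apply: (visible_antipode Ox r0 rCO' ar bbr xa).
  apply: (@off_ray_dot _ _ w) => //; first by rewrite dotC.
  by rewrite dotDr dotZr bw add0r gt_eqF // mulr_gt0 // dot_gt0.
have con : connected Omega by exact: component_connected.
have E : Omega `&` closure (visible x) = Omega.
  apply: con.
  - exists x; split=> //; apply: subset_closure => t t01.
    by rewrite subrr scaler0 addr0.
  - exists ([set z | CO z -> closure (visible x) z]°); first exact: open_interior.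
    rewrite eqEsubset; split=> z [Oz h]; split=> //; first exact: clop.
    by have := interior_subset h; apply; exact: component_cone.
  - by exists (closure (visible x)) => //; exact: closed_closure.
have [y1 _] := component_notM Oy.
apply: closure_visible => //; [exact: component_cone|exact: off_rayP|].
by move: Oy; rewrite -E => -[].
Qed.

Lemma component_convex x y (s t : R) : Omega x -> Omega y -> 0 <= s -> 0 <= t ->
  s *: x + t *: y != 0 -> CO (s *: x + t *: y).
Proof.
move=> Ox Oy s0 t0 st0.
have coneZ (c : R) z : 0 < c -> CO z -> CO (c *: z).
  by move=> c0 [z0 Oz]; split; rewrite ?nrmZ // scaler_eq0 negb_or gt_eqF.
have [yx|yx] := eqVneq y (- x).
  have [st|st|st] := ltrgtP s t; last first.
  - by move: st0; rewrite yx st scalerN subrr eqxx.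
  - have -> : s *: x + t *: y = (s - t) *: x by rewrite yx scalerN -scalerBl.
    by apply: coneZ; [rewrite subr_gt0|exact: component_cone].
  have -> : s *: x + t *: y = (t - s) *: y.
    by rewrite scalerBl addrC yx !scalerN opprK.
  by apply: coneZ; [rewrite subr_gt0|exact: component_cone].
have st : 0 < s + t.
  rewrite lt_def addr_ge0 // andbT paddr_eq0 //; apply: contraNN st0.
  by move=> /andP[/eqP -> /eqP ->]; rewrite !scale0r addr0.
have -> : s *: x + t *: y = (s + t) *: (x + (t / (s + t)) *: (y - x)).
  rewrite scalerDr scalerA mulrCA divff ?gt_eqF // mulr1 scalerBr scalerDl.
  by rewrite addrA addrAC addrK.
apply: coneZ => //; apply: component_visible => //.
by rewrite divr_ge0 ?(ltW st) //= ler_pdivrMr // mul1r lerDr.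
Qed.

End Convexity.

(** * Uniqueness of the convex body *)

Section ConvexBodies.
Variables (R : realType) (n : nat).
Implicit Types (C L : set 'rV[R]_n.+2) (a q x y z : 'rV[R]_n.+2).

Lemma notin_sphere_boundary C x : C `<=` sphere R n -> C x ->
  (\forall y \near x, C (nrm y)) <-> ~ sphere_boundary C x.
Proof.
move=> CS Cx; have x1 : dot x x = 1 by exact: CS.
have x0 := unit_neq0 x1; split=> [nC [_ cl]|nb].
  by have [y [[y1 nCy] /=]] := cl _ nC; rewrite nrm_id.
have [B [nB BC]] : exists B, nbhs x B /\ forall y, B y -> sphere R n y -> C y.
  apply: contrapT => h; apply: nb; split; first exact: subset_closure.
  move=> B nB; apply: contrapT => h'; apply: h; exists B; split=> // y By y1.
  by apply: contrapT => nCy; apply: h'; exists y.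
have h1 : \forall y \near x, B (nrm y).
  have : nbhs (nrm x) B by rewrite nrm_id.
  exact: (nrm_continuous x0).
have h2 := near_neq0 x0.
by apply: filterS2 h1 h2 => y By y0; apply: BC => //; exact: dot_nrm.
Qed.

Lemma sphere_convex_cone C x y (s t : R) : C `<=` sphere R n -> sphere_convex C ->
  cone C x -> cone C y -> 0 <= s -> 0 <= t -> s *: x + t *: y != 0 ->
  cone C (s *: x + t *: y).
Proof.
move=> CS cC [x0 Cx] [y0 Cy] s0 t0 st0; split=> //.
set w := s *: x + t *: y in st0 *.
have e : nrm w = (inv_norm w * s * (inv_norm x)^-1) *: nrm x +
    (inv_norm w * t * (inv_norm y)^-1) *: nrm y.
  by rewrite -!scalerA -!nrmK // -scalerDr.
rewrite e; apply: cC => //; last by rewrite -e; exact: dot_nrm.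
- by rewrite !mulr_ge0 ?invr_ge0 // ltW // inv_norm_gt0.
- by rewrite !mulr_ge0 ?invr_ge0 // ltW // inv_norm_gt0.
Qed.

Lemma cone_unit C x : dot x x = 1 -> cone C x <-> C x.
Proof.
by move=> x1; rewrite /cone /= nrm_id //; split=> [[]|] //; split=> //;
  exact: unit_neq0.
Qed.

Lemma coneZ C x (c : R) : 0 < c -> cone C x -> cone C (c *: x).
Proof.
by move=> c0 [x0 Cx]; split; rewrite ?nrmZ // scaler_eq0 negb_or gt_eqF.
Qed.

Lemma near_cone C x : x != 0 -> (\forall y \near nrm x, C (nrm y)) ->
  \forall y \near x, cone C y.
Proof.
move=> x0 nC.
have h1 := near_neq0 x0.
have h2 : \forall y \near x, C (nrm (nrm y)) by exact: (nrm_continuous x0 nC).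
apply: filterS2 h1 h2 => y y0; rewrite nrm_id; first by split.
exact: dot_nrm.
Qed.

Lemma near_nrm C x : x != 0 -> (\forall y \near x, cone C y) ->
  \forall y \near nrm x, C (nrm y).
Proof.
move=> x0 /near_ball[r r0 rC]; have i0 := inv_norm_gt0 x0.
have c0 : 0 < (inv_norm x)^-1 by rewrite invr_gt0.
apply/near_ball; exists (inv_norm x * r) => [|y yx]; first exact: mulr_gt0.
rewrite -(nrmZ y c0); apply: (rC _ _).2.
rewrite [X in _ - X](nrmK x0) -scalerBr normrZ (gtr0_norm c0).
by rewrite ltr_pdivrMl.
Qed.

(** As s > 0, a perturbation of the combination is absorbed by the interior point a. *)
Lemma interior_join C a q (s t : R) : C `<=` sphere R n -> sphere_convex C ->
  C a -> (\forall y \near a, C (nrm y)) -> C q -> 0 < s -> 0 <= t ->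
  s *: a + t *: q != 0 -> \forall y \near s *: a + t *: q, cone C y.
Proof.
move=> CS cC Ca nC Cq s0 t0 b0; set b := s *: a + t *: q in b0 *.
have a0 := unit_neq0 (CS _ Ca).
have q1 : dot q q = 1 by exact: CS.
have : \forall y \near a, cone C y by apply: near_cone => //; rewrite nrm_id //;
  exact: CS.
move=> /near_ball[r r0 rC].
have h1 := near_neq0 b0.
have h2 : \forall y \near b, `|y - b| < s * r.
  by apply/near_ball; exists (s * r) => //; exact: mulr_gt0.
apply: filterS2 h1 h2 => y y0 yb.
have e : y = s *: (a + s^-1 *: (y - b)) + t *: q.
  by rewrite scalerDr scalerA divff ?gt_eqF // scale1r addrAC -/b addrC subrK.
rewrite e; apply: sphere_convex_cone => //; last by rewrite -e.
- apply: rC; rewrite addrAC subrr add0r normrZ normfV (gtr0_norm s0).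
  by rewrite ltr_pdivrMl.
- exact/cone_unit.
- exact: ltW.
Qed.

(** Walk from a to q. Before q the points are interior to C2, so they avoid the common boundary L;
    hence the walk cannot leave the interior of C1. *)
Lemma convex_body_subset C1 C2 L a : L !=set0 ->
  is_convex_body C1 -> is_convex_body C2 ->
  sphere_boundary C1 = L -> sphere_boundary C2 = L ->
  C1 a -> C2 a -> ~ L a -> C2 `<=` C1.
Proof.
move=> [l Ll] [C1S clC1 cvC1 _] [C2S clC2 cvC2 _] b1 b2 C1a C2a nLa q C2q.
have n1 : \forall y \near a, C1 (nrm y) by apply/notin_sphere_boundary; rewrite ?b1.
have n2 : \forall y \near a, C2 (nrm y) by apply/notin_sphere_boundary; rewrite ?b2.
have a1 : dot a a = 1 by exact: C1S.
have q1 : dot q q = 1 by exact: C2S.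
have a0 := unit_neq0 a1.
apply: contrapT => nC1q.
(* Any w is a positive combination of a + e w and - a. So a convex set containing - a and a
   neighbourhood of a is the whole sphere, whose boundary is empty. *)
have qa : q != - a.
  apply/eqP => qa; have C2full : sphere R n `<=` C2.
    move=> w w1; have w0 := unit_neq0 w1.
    have : \forall y \near a, cone C2 y by apply: near_cone => //; rewrite nrm_id.
    move=> /(near0_line w)/near0_ball[e e0 he].
    have e2 : 0 < e / 2 by rewrite divr_gt0.
    have [|aw0 C2aw] := he (e / 2); first by rewrite gtr0_norm //; lra.
    apply/(cone_unit _ w1).
    have ew : w = (e / 2)^-1 *: (a + (e / 2) *: w) + (e / 2)^-1 *: q.
      by rewrite qa scalerDr scalerN addrAC subrr add0r scalerK // gt_eqF.
    rewrite ew; apply: sphere_convex_cone; rewrite -?ew ?invr_ge0 ?(ltW e2) //.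
    exact/cone_unit.
  have : sphere_boundary C2 l by rewrite b2.
  move=> [_ cl]; have [] := cl setT; first exact: filterT.
  by move=> y [[y1]]; have := C2full y y1.
have seg0 (t : R) : 0 <= t <= 1 -> a + t *: (q - a) != 0 by exact: off_rayP.
pose A := [set y | cone C1 y]°.
have sub : [set a + t *: (q - a) | t in `[0 : R, 1]] `<=` A.
  apply: connected_clopen; first exact: connected_seg.
  - exists a; split.
      by exists 0; [rewrite /= in_itv /= lexx ler01|rewrite scale0r addr0].
    by apply: near_cone => //; rewrite nrm_id.
  - exact: open_interior.
  - move=> _ [[t + <-]]; rewrite /= in_itv /= => t01; set y := a + _ => clA.
    have y0 : y != 0 by exact: seg0.
    have C1y : C1 (nrm y).
      apply: clC1 => B nB.
      have : \forall z \near y, B (nrm z) by exact: (nrm_continuous y0).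
      move=> /clA[z [/interior_subset [_ C1z] Bz]].
      by exists (nrm z).
    apply: near_cone => //; apply/notin_sphere_boundary => //; rewrite b1.
    (* At the end q itself [interior_join] gives nothing, but C1 q has been excluded. *)
    have [t1|t1] := eqVneq t 1.
      move=> Ly; apply: nC1q; move: C1y.
      by rewrite /y t1 scale1r addrC subrK nrm_id.
    case/andP: t01 => t0 t1';
      have {}t1 : 0 < 1 - t by rewrite subr_gt0 lt_def eq_sym t1.
    rewrite -b2; apply/notin_sphere_boundary => //.
      have [_] : cone C2 y; last by [].
      rewrite /y segE; apply: sphere_convex_cone; rewrite -?segE ?(ltW t1) //.
      - exact/cone_unit.
      - exact/cone_unit.
    have : \forall z \near y, cone C2 z.
      by rewrite /y segE; apply: interior_join; rewrite -?segE.
    by move=> /(near_nrm y0).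
by have [_] : cone C1 q; [apply: interior_subset; apply: sub; exists 1;
  [rewrite /= in_itv /= lexx ler01|rewrite scale1r addrC subrK]|rewrite nrm_id].
Qed.

(** Every body with boundary L contains L, hence by convexity the point s x + t y, which lies off L:
    all these bodies share an interior point. This is what fails for the two hemispheres bounded by
    a great sphere. *)
Lemma convex_body_eq C L x y (s t : R) : is_convex_body C ->
  sphere_boundary C = L -> L x -> L y -> 0 <= s -> 0 <= t ->
  C (s *: x + t *: y) -> ~ L (s *: x + t *: y) -> convex_body L = C.
Proof.
move=> bC bL Lx Ly s0 t0 Cq nLq; rewrite /convex_body; case: xgetP => [D _|];
  last first.
  by move=> /(_ C) []; split.
move=> [bD bDL].
have LD z : L z -> D z.
  by rewrite -bDL => -[+ _]; case: bD => _ clD _ _; apply: clD.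
have Dq : D (s *: x + t *: y).
  case: bD => _ _ cD _; apply: cD => //; [exact: LD|exact: LD|].
  by case: bC => CS _ _ _; exact: CS.
have L0 : L !=set0 by exists x.
by rewrite eqEsubset; split; [exact: (convex_body_subset L0 bC bD bL bDL Cq)|
  exact: (convex_body_subset L0 bD bC bDL bL Dq)].
Qed.

End ConvexBodies.

(** * The convex body of M and its polar *)

Section StrictlyConvexBody.
Variables (R : realType) (n : nat) (M : set 'rV[R]_n.+2) (p : 'rV[R]_n.+2).
Hypotheses (n_gt0 : (0 < n)%N) (M_hyp : is_hypersurface M).
Hypotheses (M_nonempty : M !=set0) (M_compact : compact M).
Hypothesis Mp : (sphere R n `\` M) p.
Let Omega := connected_component (sphere R n `\` M) p.
Hypothesis M_convex : forall x, M x ->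
  exists N : 'rV[R]_n.+2 -> 'rV[R]_n.+2,
    [/\ differentiable N x,
        \forall y \near x, M y -> unit_normal_into M Omega y (N y) &
        forall v, tangent M x v -> v <> 0 -> 0 < second_ff N x v v].
Let CO := cone Omega.
Let K := Omega `|` M.
Implicit Types k m v w x y z nu : 'rV[R]_n.+2.

Let MS : M `<=` sphere R n. Proof. by case: M_hyp. Qed.

Lemma inner_normal x : M x -> exists nu, unit_normal_into M Omega x nu.
Proof. by move=> Mx; have [N [_ /nbhs_singleton h _]] := M_convex Mx; exists (N x);
  exact: h. Qed.

Lemma strict_support z d : M z ->
  (\forall t \near (0 : R), cone K (z + t *: d)) -> d = dot z d *: z.
Proof.
move=> Mz Kd; have [N [dN NM II]] := M_convex Mz.
exact: (strict_direction M_hyp Mz dN NM II Kd).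
Qed.

Lemma body_sphere : K `<=` sphere R n.
Proof. by move=> x [/component_notM[]|/MS]. Qed.

Lemma closed_body : closed K.
Proof.
rewrite /closed closureU => x [/(closure_component M_compact)//|clMx]; right.
by apply: compact_closed clMx => //; exact: norm_hausdorff.
Qed.

(** Stronger than the definition of the normal: the outward geodesic avoids M as well as Omega,
    because F < 0 on it. *)
Lemma geodesic_sides x nu : M x -> unit_normal_into M Omega x nu ->
  \forall t \near (0 : R), 0 < t ->
    Omega (cos t *: x + sin t *: nu) /\ ~ K (cos t *: x - sin t *: nu).
Proof.
move=> Mx xnu; have [U [F [Ux dF nuF [r r0 ch]]]] := inner_chart M_hyp Mx xnu.
have [nu1 xnu0 _ _] := xnu; have x1 : dot x x = 1 by exact: MS.
have clo w : \forall t \near (0 : R), `|cos t *: x + sin t *: w - x| < r.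
  apply: (near_geodesic w (B := [set y | `|y - x| < r])).
  by apply/(near_ball x [set y | `|y - x| < r]); exists r.
apply: filterS3 (geodesic_sign M_hyp dF Ux Mx nuF) (clo nu) (clo (- nu)).
move=> t [Fp Fm] /ch[Up COp]; rewrite scalerN => /ch[Um COm] t0; split.
  by apply: (@cone_component _ _ M); [exact: geodesic_unit|apply/COp; exact: Fp].
have u1 : dot (cos t *: x - sin t *: nu) (cos t *: x - sin t *: nu) = 1.
  by rewrite -scalerN; apply: geodesic_unit; rewrite ?dotNl ?dotNr ?xnu0 ?oppr0 ?opprK.
by move=> /(cone_unit _ u1)/(body_chart dF Um COm); rewrite leNgt Fm.
Qed.

Lemma body_closure : K `<=` closure Omega.
Proof.
move=> x [|Mx]; first exact: subset_closure.
move=> B nB; have [nu xnu] := inner_normal Mx.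
have : \forall t \near (0 : R), 0 < t -> (Omega `&` B) (cos t *: x + sin t *: nu).
  apply: filterS2 (geodesic_sides Mx xnu) (near_geodesic nu nB) => t h Bt t0.
  by split=> //; have [] := h t0.
by move=> /near_pos[t _ h]; exists (cos t *: x + sin t *: nu).
Qed.

(** K is the closure of Omega, and [component_convex] passes to the limit, the nearby combinations
    being nonzero. *)
Lemma body_convex : sphere_convex K.
Proof.
move=> x y s t Kx Ky s0 t0 st1; have st0 := unit_neq0 st1.
apply: (closure_component M_compact) => B nB.
set w := s *: x + t *: y in st1 st0 nB.
have h1 : \forall z \near w, B (nrm z).
  have : nbhs (nrm w) B by rewrite nrm_id.
  exact: (nrm_continuous st0).
have h2 := near_neq0 st0.
have : \forall z \near w, B (nrm z) /\ z != 0 by apply: filterS2 h1 h2.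
move=> /near_ball[r r0 h]; pose e := r / (s + t + 1).
have c0 : 0 < s + t + 1 by rewrite ltr_wpDl // addr_ge0.
have e0 : 0 < e by rewrite divr_gt0.
have ball (u : 'rV[R]_n.+2) : nbhs u [set u' | `|u' - u| < e].
  by apply/(near_ball u [set u' | `|u' - u| < e]); exists e.
have [x' [Ox' /= xx']] := body_closure Kx (ball x).
have [y' [Oy' /= yy']] := body_closure Ky (ball y).
have [|Bw w0] := h (s *: x' + t *: y').
  rewrite /w opprD addrACA -!scalerBr.
  apply: (le_lt_trans (ler_normD _ _)); rewrite !normrZ !ger0_norm //.
  have : s * `|x' - x| <= s * e by rewrite ler_wpM2l // ltW.
  have : t * `|y' - y| <= t * e by rewrite ler_wpM2l // ltW.
  have : (s + t + 1) * e = r by rewrite /e mulrC divfK // gt_eqF.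
  by rewrite !mulrDl; lra.
exists (nrm (s *: x' + t *: y')); split=> //.
by have [] := component_convex n_gt0 M_hyp M_compact strict_support Ox' Oy' s0 t0 w0.
Qed.

Lemma component_interior x : Omega x -> \forall y \near x, CO y.
Proof.
move=> Ox; apply: open_nbhs_nbhs; split; first exact: open_cone.
exact: component_cone.
Qed.

Lemma body_boundary : sphere_boundary K = M.
Proof.
rewrite eqEsubset; split=> x; last first.
  move=> Mx; split; first by apply: subset_closure; right.
  move=> B nB; have [nu xnu] := inner_normal Mx.
  have [nu1 xnu0 _ _] := xnu; have x1 : dot x x = 1 by exact: MS.
  have : \forall t \near (0 : R), 0 < t ->
      ((sphere R n `\` K) `&` B) (cos t *: x + sin t *: - nu).
    apply: filterS2 (geodesic_sides Mx xnu) (near_geodesic (- nu) nB) => t h Bt t0.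
    split=> //; split; last by rewrite scalerN; have [] := h t0.
    by apply: geodesic_unit; rewrite ?dotNl ?dotNr ?xnu0 ?oppr0 ?opprK.
  by move=> /near_pos[t _ h]; exists (cos t *: x + sin t *: - nu).
move=> bx; have Kx : K x by case: bx => + _; exact: closed_body.
case: (Kx) => // Ox; exfalso; move: bx; apply/notin_sphere_boundary => //.
  exact: body_sphere.
by apply: filterS (component_interior Ox) => y [_ ?]; left.
Qed.

Lemma body_is_convex : is_convex_body K.
Proof.
split; [exact: body_sphere|exact: closed_body|exact: body_convex|].
exists p; rewrite body_boundary; split; last by case: Mp.
by left; exact: connected_component_refl.
Qed.

Lemma body_segment (x : 'rV[R]_n.+2) y (s t : R) :
  cone K x -> cone K y -> 0 <= s -> 0 <= t ->
  s *: x + t *: y != 0 -> cone K (s *: x + t *: y).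
Proof. by apply: sphere_convex_cone; [exact: body_sphere|exact: body_convex]. Qed.

(** K would contain the closed half space, hence a line through x orthogonal to both x and y,
    against [strict_support]. *)
Lemma half_space x y : M x -> dot x y = 0 -> y != 0 ->
  (forall w, 0 < dot w y -> cone K w) -> False.
Proof.
move=> Mx xy y0 half; have x1 : dot x x = 1 by exact: MS.
have clhalf w : w != 0 -> 0 <= dot w y -> cone K w.
  move=> w0 wy; split=> //; apply: closed_body => B nB.
  have : \forall t \near (0 : R), B (nrm (w + t *: y)).
    have : \forall z \near w, B (nrm z) by exact: (nrm_continuous w0).
    exact: near0_line.
  have h t : 0 < t -> cone K (w + t *: y).
    move=> t0; apply: half; rewrite dotDl dotZl ltr_wpDl // mulr_gt0 //.
    by rewrite dot_gt0.
  move=> hB; have [|t _ [Kt Bt]] := @near_pos _ (fun t =>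
    K (nrm (w + t *: y)) /\ B (nrm (w + t *: y))).
    by apply: filterS hB => t Bt /h[].
  by exists (nrm (w + t *: y)).
have [v [v0 xv yv]] := exists_orth x y n_gt0.
have := @strict_support x v Mx; rewrite xv scale0r => strict.
suff : v = 0 by move/eqP; rewrite (negbTE v0).
apply: strict; apply: filterE => t; apply: clhalf.
  apply/eqP => e; have : dot x (x + t *: v) = 0 by rewrite e dot0r.
  by rewrite dotDr dotZr xv mulr0 addr0 x1 => /eqP; rewrite oner_eq0.
by rewrite dotDl dotZl xy (dotC v) yv mulr0 addr0.
Qed.

(** By convexity x + t k stays in the cone over K for small t > 0, so F >= 0 there and its
    derivative along k, a positive multiple of <k, nu>, is nonnegative. *)
Lemma support x nu k : M x -> unit_normal_into M Omega x nu -> K k -> 0 <= dot k nu.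
Proof.
move=> Mx xnu Kk; have [U [F [Ux dF nuF [r r0 ch]]]] := inner_chart M_hyp Mx xnu.
have [nu1 xnu0 tnu _] := xnu.
have [_ E] := normal_gradient dF MS Ux Mx nu1 xnu0 tnu.
suff : 0 <= 'D_k F x by rewrite E pmulr_lge0 // dotC.
have dl : is_derive (0 : R) (1 : R) (fun t => F (x + t *: k)) ('D_k F x).
  have := is_derive_comp (is_derive_line x k (0 : R)); rewrite scale0r addr0.
  by apply; exact: df_diff dF _ Ux.
have F0 : F (x + (0 : R) *: k) = 0 by rewrite scale0r addr0 (defining_M dF).
apply: (derive_ge0_right dl F0).
have : \forall t \near (0 : R), `|x + t *: k - x| < r.
  apply: (@near0_line _ _ _ _ (fun w => `|w - x| < r)).
  by apply/near_ball; exists r.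
apply: filterS => t /ch[Ut COt] t0; apply/(body_chart dF Ut COt).
have := df_neq0 dF Ut; rewrite -[X in X + _ != 0]scale1r => h.
have cKx : cone K x by apply/cone_unit; [exact: MS|right].
have cKk : cone K k by apply/cone_unit => //; exact: body_sphere.
by have := body_segment cKx cKk ler01 (ltW t0) h; rewrite scale1r.
Qed.

(** [CO] is open, so k can be moved slightly against nu before applying [support]. *)
Lemma support_component x nu k : M x -> unit_normal_into M Omega x nu -> CO k ->
  0 < dot k nu.
Proof.
move=> Mx xnu COk; have [nu1 _ _ _] := xnu.
have : \forall y \near k, CO y by apply: open_nbhs_nbhs; split=> //; exact: open_cone.
move=> /(near0_line (- nu)) h.
have [|t t0 [w0 Ot]] := @near_pos _ (fun t => CO (k + t *: - nu)).
  by apply: filterS h.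
have : 0 <= dot (nrm (k + t *: - nu)) nu by apply: (support Mx xnu); left.
rewrite dotZl pmulr_rge0 ?inv_norm_gt0 // dotDl dotZl dotNl nu1; lra.
Qed.

(** If <w, nu> > 0, a small step x + t w enters [CO]; adding - x would give w in the cone over K. So
    K would contain a half space bounded at x. *)
Lemma body_no_antipode x : M x -> ~ K (- x).
Proof.
move=> Mx KNx; have [nu xnu] := inner_normal Mx.
have [nu1 xnu0 tnu _] := xnu.
have [U [F [Ux dF nuF [r r0 ch]]]] := inner_chart M_hyp Mx xnu.
have [_ E] := normal_gradient dF MS Ux Mx nu1 xnu0 tnu.
apply: (half_space Mx xnu0 (unit_neq0 nu1)) => w wnu.
have dl : is_derive (0 : R) (1 : R) (fun t => F (x + t *: w)) ('D_w F x).
  have := is_derive_comp (is_derive_line x w (0 : R)); rewrite scale0r addr0.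
  by apply; exact: df_diff dF _ Ux.
have F0 : F (x + (0 : R) *: w) = 0 by rewrite scale0r addr0 (defining_M dF).
have wF : 0 < 'D_w F x by rewrite E mulr_gt0 // dotC.
have h1 : \forall t \near (0 : R), `|x + t *: w - x| < r.
  apply: (@near0_line _ _ _ _ (fun y => `|y - x| < r)).
  by apply/near_ball; exists r.
have [|t t0 [xt0 Ot]] := @near_pos _ (fun t => CO (x + t *: w)).
  by apply: filterS2 h1 (derive_pos_sign dl F0 wF) => t /ch[_ COt] [Ft _] /Ft /COt.
have ew : w = t^-1 *: (x + t *: w) + t^-1 *: - x.
  by rewrite -scalerDr addrAC subrr add0r scalerK // gt_eqF.
rewrite ew; apply: body_segment; rewrite -?ew ?invr_ge0 ?(ltW t0) //.
- by split=> //; left.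
- by apply/cone_unit => //; rewrite dotNl dotNr opprK; exact: MS.
- by rewrite -dot_gt0; apply: contraTT wnu; rewrite dot_gt0 negbK => /eqP ->;
  rewrite dot0l ltxx.
Qed.

(** The midpoint is over K by convexity. Were it over M, [strict_support] would make y - x
    proportional to x + y. *)
Lemma body_strict x y : K x -> K y -> y != x -> y != - x -> CO (x + y).
Proof.
move=> Kx Ky yx yNx.
have x1 : dot x x = 1 by exact: body_sphere.
have y1 : dot y y = 1 by exact: body_sphere.
have cKx : cone K x by apply/cone_unit.
have cKy : cone K y by apply/cone_unit.
have off : off_ray x y by exact: off_rayP.
have seg (t : R) : 0 <= t <= 1 -> cone K (x + t *: (y - x)).
  move=> t01; have := off t t01; rewrite segE; case/andP: t01 => t0 t1.
  by apply: body_segment => //; rewrite subr_ge0.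
pose w := x + (1 / 2 : R) *: (y - x).
have exy : x + y = (2 : R) *: w.
  rewrite scalerDr scalerA mulrCA divff // mulr1 scale1r.
  by rewrite scaler_nat mulr2n addrACA subrr addr0.
have h0 : (0 : R) <= (1 / 2 : R) <= 1 by apply/andP; split; lra.
have [w0 Kw] : cone K w by exact: seg.
rewrite exy; apply: coneZ => //; split=> //; case: Kw => // Mw; exfalso.
set c := inv_norm w; have c0 : 0 < c by exact: inv_norm_gt0.
have := @strict_support (nrm w) (c *: (y - x)) Mw.
set k := dot _ _ => /(_ _)h.
have {}h : c *: (y - x) = k *: nrm w.
  apply: h; apply/near0_ball; exists (1 / 2) => // t th.
  rewrite /nrm -/c scalerA mulrC -scalerA -scalerDr /w -addrA -scalerDl.
  by apply: coneZ => //; apply: seg; move: th; rewrite ltr_norml => /andP[? ?];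
    apply/andP; split; lra.
have {}h : y - x = k *: w.
  by apply: (@scalerI _ _ c); rewrite ?gt_eqF // h /nrm -/c !scalerA mulrC.
(* Comparing the norms of the two sides gives k = 0. *)
have e1 : (1 - k / 2) *: y = (1 + k / 2) *: x.
  have e : y - x = (k / 2) *: (x + y) by rewrite exy scalerA divfK.
  apply/eqP; rewrite scalerBl scalerDl !scale1r subr_eq -addrA -scalerDr -e.
  by rewrite addrC subrK.
have : dot ((1 - k / 2) *: y) ((1 - k / 2) *: y) = dot ((1 + k / 2) *: x) ((1 + k / 2) *: x).
  by rewrite e1.
rewrite !dotZl !dotZr x1 y1 => sq; have k0 : k = 0 by nra.
by move: h; rewrite k0 scale0r => /eqP; rewrite subr_eq0 (negbTE yx).
Qed.

(** A curve of M through x with nonzero velocity stays close to x, hence away from - x; if it only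
    took the value x, its velocity would be 0. *)
Lemma two_points : exists x y, [/\ M x, M y, y != x & y != - x].
Proof.
have [x Mx] := M_nonempty; have x1 : dot x x = 1 by exact: MS.
have [nu xnu] := inner_normal Mx; have [nu1 xnu0 tnu _] := xnu.
have [U [F [Ux dF nuF _]]] := inner_chart M_hyp Mx xnu.
have [_ E] := normal_gradient dF MS Ux Mx nu1 xnu0 tnu.
have [v [v0 xv nuv]] := exists_orth x nu n_gt0.
have [g [g0 Mg dg]] : tangent M x v.
  by apply: (kernel_tangent dF MS Ux Mx xv); rewrite E nuv mul0r.
have gx : \forall t \near (0 : R), 0 < dot (g t) x.
  have : {for 0, continuous (fun t => dot (g t) x)}.
    apply: differentiable_continuous; apply: differentiable_dotr => //.
    by apply/derivable1_diffP; case: dg.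
  by move=> /cvgr_gt; apply; rewrite g0 x1 ltr01.
have [t [Mgt gtx gtNx]] : exists t, [/\ M (g t), g t != x & g t != - x].
  apply: contrapT => no.
  have e : \forall t \near (0 : R), cst x t = g t.
    apply: filterS2 Mg gx => t Mgt gtx /=.
    apply: contrapT => gt; apply: no; exists t; split=> //.
      by apply/eqP => e; apply: gt.
    apply: contraTneq gtx => ->; rewrite dotNl x1; lra.
  have [_] := near_eq_is_derive e (is_derive_cst x (0 : R) (1 : R)).
  by case: dg => _ -> /eqP; rewrite (negbTE v0).
by exists x, (g t).
Qed.

Lemma convex_bodyE : convex_body M = K.
Proof.
have [x [y [Mx My yx yNx]]] := two_points.
have [w0 Ow] : CO (x + y) by apply: body_strict => //; right.
have e : nrm (x + y) = inv_norm (x + y) *: x + inv_norm (x + y) *: y.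
  by rewrite -scalerDr.
have i0 : 0 <= inv_norm (x + y) by rewrite ltW // inv_norm_gt0.
apply: (convex_body_eq body_is_convex body_boundary Mx My i0 i0); rewrite -e.
  by left.
by have [] := component_notM Ow.
Qed.

(** Any unit normal is proportional to the gradient of F, so nu is N or - N, and the side condition
    settles the sign. *)
Lemma exterior_normalP x nu : M x ->
  exterior_normal M x nu <-> unit_normal_into M Omega x (- nu).
Proof.
move=> Mx; rewrite /exterior_normal convex_bodyE; split.
  move=> [nu1 xnu0 tnu side].
  have [N xN] := inner_normal Mx; have [N1 xN0 tN _] := xN.
  have [U [F [Ux dF NF _]]] := inner_chart M_hyp Mx xN.
  have [_ E1] := normal_gradient dF MS Ux Mx N1 xN0 tN.
  have [_ E2] := normal_gradient dF MS Ux Mx nu1 xnu0 tnu.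
  set c := dot N nu; have nuF : 'D_nu F x = c * 'D_N F x by exact: E1.
  have cc : c * c = 1.
    have := E2 N; rewrite nuF (dotC nu) -/c mulrA -[LHS]mul1r.
    by move/(mulIf (lt0r_neq0 NF)).
  have Nnu : N = c *: nu.
    apply: dot_inj => b; rewrite dotZl; apply: (mulIf (lt0r_neq0 NF)).
    by rewrite -E1 E2 nuF; ring.
  have [c1|c1] : c = 1 \/ c = -1.
    have /eqP : (c - 1) * (c + 1) = 0 by rewrite mulrDr !mulrBl cc; ring.
    by rewrite mulf_eq0 subr_eq0 addr_eq0 => /orP[/eqP|/eqP]; [left|right].
  (* With nu = N the same geodesic would start inside Omega and outside K. *)
  - exfalso; have {}Nnu : N = nu by rewrite Nnu c1 scale1r.
    rewrite Nnu in xN; have h := geodesic_sides Mx xN.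
    have := near_pos (P := fun t => Omega (cos t *: x + sin t *: nu) /\ 
      (sphere R n `\` K) (cos t *: x + sin t *: nu)).
    case; last by move=> t _ [Ot [_]]; apply; left.
    have {}side : \forall t \near (0 : R), 0 < t ->
        (sphere R n `\` K) (cos t *: x + sin t *: nu) /\
        ~ (sphere R n `\` K) (cos t *: x - sin t *: nu) by exact: side.
    have side' : \forall t \near (0 :
      R), 0 < t -> (sphere R n `\` K) (cos t *: x + sin t *: nu).
      by apply: filterS side => t s /s[].
    by apply: filterS2 h side' => t h1 h2 t0; split; [have [] := h1 t0|exact: h2].
  - suff -> : - nu = N by [].
    by rewrite Nnu c1 scaleN1r.
move=> xN; have [N1 xN0 tN _] := xN; split.
- by rewrite -N1 dotNl dotNr opprK.
- by move/eqP: xN0; rewrite dotNr oppr_eq0 => /eqP.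
- by move=> v /tN /eqP; rewrite dotNr oppr_eq0 => /eqP.
have x1 : dot x x = 1 by exact: MS.
have : \forall t \near (0 : R), 0 < t ->
    (sphere R n `\` K) (cos t *: x + sin t *: nu) /\
    ~ (sphere R n `\` K) (cos t *: x - sin t *: nu); last by [].
apply: filterS (geodesic_sides Mx xN) => t h t0.
have [Op Km] := h t0; rewrite !scalerN opprK in Op Km.
split; last by move=> [_]; apply; left.
split=> //; rewrite -[nu]opprK scalerN -scalerN; apply: geodesic_unit => //.
  by rewrite opprK -N1 dotNl dotNr opprK.
by rewrite opprK; move/eqP: xN0; rewrite dotNr oppr_eq0 => /eqP.
Qed.

(** * The polar set and the Gauss image *)

Lemma polar_witness y : sphere R n y ->
  polar M y <-> (forall x, M x -> dot x y <= 0) /\ exists2 x, M x & dot x y = 0.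
Proof.
move=> y1; have [m Mm] := M_nonempty.
have [x /set_mem Mx xmax] :
  exists2 c, c \in M & forall t, t \in M -> dot t y <= dot c y.
  apply: (@EVT_max_rV _ _ (fun x => dot x y)) => //.
  exact/continuous_subspaceT/dot_continuous.
have ub : ubound [set dot x y | x in M] (dot x y).
  by move=> _ [z Mz <-]; apply: xmax; exact: mem_set.
have e : sup [set dot x y | x in M] = dot x y.
  apply/eqP; rewrite eq_le; apply/andP; split.
    by apply: ge_sup => //; exists (dot m y), m.
  by apply: ub_le_sup; [exists (dot x y)|exists x].
rewrite /polar /= e; split=> [[_ xy0]|[le0 [z Mz z0]]].
  by split; [move=> z Mz; rewrite -xy0; apply: ub; exists z|exists x].
split=> //; apply/eqP; rewrite eq_le le0 //= -z0.
by apply: ub; exists z.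
Qed.

(** If <k, y> > 0 with k in Omega, the open half space of y avoids the cone over M and contains k,
    so it lies in [CO]. For m in M, either <m, y> = 0, against [half_space], or - m is in that half
    space, against [body_no_antipode]. *)
Lemma polar_body y : (forall x, M x -> dot x y <= 0) -> forall k, K k -> dot k y <= 0.
Proof.
move=> My k [Ok|/My//]; rewrite leNgt; apply/negP => ky.
have half w : 0 < dot w y -> CO w.
  move=> wy; apply: (component_seg (component_cone Ok)) => t /andP[t0 t1].
  have pos : 0 < dot (k + t *: (w - k)) y.
    rewrite segE dotDl !dotZl.
    have [->|tn0] := eqVneq t 0; first by rewrite subr0 mul1r mul0r addr0.
    by rewrite ltr_wpDl // ?mulr_ge0 ?subr_ge0 // ?(ltW ky) // mulr_gt0 // lt_def tn0.
  have z0 : k + t *: (w - k) != 0.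
    by apply: contraTneq pos => ->; rewrite dot0l ltxx.
  split=> // /My; rewrite dotZl leNgt; apply/negP; rewrite negbK.
  by rewrite mulr_gt0 // inv_norm_gt0.
have [m Mm] := M_nonempty.
have y0 : y != 0 by apply: contraTneq ky => ->; rewrite dot0r ltxx.
have := My _ Mm; rewrite le_eqVlt => /orP[/eqP my|my].
  by apply: (half_space Mm my y0) => w /half[w0 Ow]; split=> //; left.
apply: (body_no_antipode Mm).
have m1 : dot (- m) (- m) = 1 by rewrite dotNl dotNr opprK; exact: MS.
by apply/(cone_unit _ m1); have [|w0 Ow] := half (- m);
  [rewrite dotNl oppr_gt0|split=> //; left].
Qed.

Lemma polar_gaussE : polar M = gauss_image M.
Proof.
rewrite eqEsubset; split=> y; last first.
  move=> [x Mx /(exterior_normalP _ Mx) xN]; have [N1 xN0 _ _] := xN.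
  have y1 : sphere R n y by rewrite /sphere /= -N1 dotNl dotNr opprK.
  apply/polar_witness => //; split.
    by move=> z Mz; rewrite -oppr_ge0 -dotNr; apply: (support Mx xN); right.
  by exists x => //; move/eqP: xN0; rewrite dotNr oppr_eq0 => /eqP.
move=> py; have y1 : sphere R n y by case: py.
have [le0 [x Mx xy]] := (polar_witness y1).1 py.
have Ky := polar_body le0.
exists x => //; apply/exterior_normalP => //.
have [N xN] := inner_normal Mx; have [N1 xN0 tN _] := xN.
suff -> : - y = N by [].
have [U [F [Ux dF NF [r r0 ch]]]] := inner_chart M_hyp Mx xN.
have [_ E] := normal_gradient dF MS Ux Mx N1 xN0 tN.
(* A small step x + t w enters [CO], where <., y> is nonpositive, while <x, y> = 0. *)
have half w : 0 < dot w N -> dot w y <= 0.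
  move=> wN; have wF : 0 < 'D_w F x by rewrite E mulr_gt0 // dotC.
  have dl : is_derive (0 : R) (1 : R) (fun t => F (x + t *: w)) ('D_w F x).
    have := is_derive_comp (is_derive_line x w (0 : R)); rewrite scale0r addr0.
    by apply; exact: df_diff dF _ Ux.
  have F0 : F (x + (0 : R) *: w) = 0 by rewrite scale0r addr0 (defining_M dF).
  have h1 : \forall t \near (0 : R), `|x + t *: w - x| < r.
    apply: (@near0_line _ _ _ _ (fun z => `|z - x| < r)).
    by apply/near_ball; exists r.
  have [|t t0 [z0 Ot]] := @near_pos _ (fun t => CO (x + t *: w)).
    by apply: filterS2 h1 (derive_pos_sign dl F0 wF) => t /ch[_ COt] [Ft _] /Ft /COt.
  have : dot (nrm (x + t *: w)) y <= 0 by apply: Ky; left.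
  by rewrite dotZl pmulr_rle0 ?inv_norm_gt0 // dotDl xy add0r dotZl pmulr_rle0.
pose c := dot N y.
(* All vectors N + l (y - c N) have scalar product 1 with N, so [half] applies for every l; an
   affine function of l bounded above has slope 0, which gives c * c = 1. *)
have test (l : R) : c + l * (1 - c * c) <= 0.
  have := half (N + l *: (y - c *: N)).
  rewrite !dotE N1 (dotC y N) -/c y1 mulr1 subrr mulr0 addr0.
  by apply; exact: ltr01.
have cc : 1 - c * c = 0.
  apply/eqP; apply: contrapT => /negP cc.
  (* This l makes the left-hand side equal to 1. *)
  have := test ((1 - c) / (1 - c * c)); rewrite divfK //; lra.
have c1 : c = -1.
  have := test 0; rewrite mul0r addr0 => c_le0.
  by nra.
apply/eqP; rewrite eq_sym -subr_eq0 opprK -dot_eq0 !dotE N1 (dotC y N) -/c c1.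
by rewrite y1; apply/eqP; ring.
Qed.

(** Otherwise x + k would be in [CO] by [body_strict], where the support inequality is strict. *)
Lemma support_eq0 x nu k : M x -> unit_normal_into M Omega x nu -> K k ->
  dot k nu = 0 -> k = x.
Proof.
move=> Mx xnu Kk knu; have [_ xnu0 _ _] := xnu.
apply: contrapT => /eqP kx; have Kx : K x by right.
have kNx : k != - x by apply/eqP => kNx; apply: (body_no_antipode Mx); rewrite -kNx.
have := support_component Mx xnu (body_strict Kx Kk kx kNx).
by rewrite dotDl xnu0 knu addr0 ltxx.
Qed.

(** * The polar of the convex body *)

Lemma dot_le1 x y : dot x x = 1 -> dot y y = 1 -> dot x y <= 1.
Proof.
move=> x1 y1; have := dot_ge0 (x - y).
by rewrite !dotE x1 y1 (dotC y x); lra.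
Qed.

Lemma dot_sqr_le x d : dot x x = 1 -> dot x d ^+ 2 <= dot d d.
Proof.
move=> x1; have := dot_ge0 (d - dot x d *: x).
by rewrite !dotE x1 (dotC d x) expr2; lra.
Qed.

Lemma body_polarP y :
  body_polar K y <-> sphere R n y /\ forall m, M m -> dot m y <= 0.
Proof.
have Kp : K p by left; exact: connected_component_refl.
split=> [[y1 sup0]|[y1 My]].
  split=> // m Mm; apply: le_trans sup0; apply: ub_le_sup; last by exists m => //;
    right.
  by exists 1 => _ [k Kk <-]; apply: dot_le1 => //; exact: body_sphere.
split=> //; apply: ge_sup; first by exists (dot p y), p.
by move=> _ [k Kk <-]; exact: polar_body.
Qed.

(** Compactness of M gives a uniform margin d < 0, the maximum of <., y>, and moving y by a
    Euclidean distance less than - d cannot exhaust it. *)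
Lemma near_strict_polar y : (forall m, M m -> dot m y < 0) ->
  \forall z \near y, forall m, M m -> dot m z < 0.
Proof.
move=> My; have [x /set_mem Mx xmax] :
    exists2 c, c \in M & forall t, t \in M -> dot t y <= dot c y.
  apply: (@EVT_max_rV _ _ (fun x => dot x y)) => //.
  exact/continuous_subspaceT/dot_continuous.
have d0 := My _ Mx; set d := dot x y in d0 xmax.
have dd : 0 < d ^+ 2 by rewrite exprn_even_gt0 //= lt_eqF.
have : \forall z \near y, dot (z - y) (z - y) < d ^+ 2.
  have : {for y, continuous (fun z => dot (z - y) (z - y))}.
    apply: differentiable_continuous; apply: differentiable_dotr.
      exact: differentiableB.
    exact: differentiableB.
  by move=> /cvgr_lt; apply; rewrite subrr dot0l.
apply: filterS => z zd m Mm.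
have my : dot m y <= d by apply: xmax; exact: mem_set.
have m1 : dot m m = 1 by exact: MS.
have := le_lt_trans (dot_sqr_le (z - y) m1) zd.
rewrite dotBr !expr2 => sq; nra.
Qed.

Lemma near_polar_notin_boundary y : sphere R n y -> (forall m, M m -> dot m y < 0) ->
  body_polar K y /\ ~ sphere_boundary (body_polar K) y.
Proof.
move=> y1 My; have Py : body_polar K y.
  by apply/body_polarP; split=> // m /My/ltW.
split=> //; apply/notin_sphere_boundary => //; first by move=> z [].
have y0 := unit_neq0 y1.
have h := near_neq0 y0.
apply: filterS2 h (near_strict_polar My) => z z0 Mz; apply/body_polarP.
split=> [|m /Mz mz]; first exact: dot_nrm.
by rewrite dotZr pmulr_rle0 ?inv_norm_gt0 // ltW.
Qed.

(** Each supporting hyperplane touches K at its base point only, so no m lies on both. *)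
Lemma body_polar_center x1 x2 nu1 nu2 : M x1 -> M x2 -> x2 != x1 ->
  unit_normal_into M Omega x1 nu1 -> unit_normal_into M Omega x2 nu2 ->
  forall m, M m -> dot m (- nu1 - nu2) < 0.
Proof.
move=> Mx1 Mx2 x21 xn1 xn2 m Mm; have Km : K m by right.
have := support Mx1 xn1 Km; have := support Mx2 xn2 Km.
rewrite dotBr dotNr => h2 h1; rewrite ltNge; apply/negP => h.
have e1 : dot m nu1 = 0 by lra.
have e2 : dot m nu2 = 0 by lra.
by move: x21; rewrite -(support_eq0 Mx1 xn1 Km e1) -(support_eq0 Mx2 xn2 Km e2) eqxx.
Qed.

(** The normalized sum of two outer normals at distinct points of M. It serves both as the interior
    point demanded by [is_convex_body] and as the point on a segment between boundary points
    demanded by [convex_body_eq]. *)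
Lemma body_polar_interior : exists y1 y2 (s : R),
  [/\ polar M y1, polar M y2, 0 <= s & sphere R n (s *: y1 + s *: y2) /\
    forall m, M m -> dot m (s *: y1 + s *: y2) < 0].
Proof.
have [x1 [x2 [Mx1 Mx2 x21 _]]] := two_points.
have [nu1 xn1] := inner_normal Mx1; have [nu2 xn2] := inner_normal Mx2.
have neg := body_polar_center Mx1 Mx2 x21 xn1 xn2.
have [m Mm] := M_nonempty.
have y0 : - nu1 - nu2 != 0.
  by apply: contraTneq (neg m Mm) => ->; rewrite dot0r ltxx.
have i0 := inv_norm_gt0 y0.
exists (- nu1), (- nu2), (inv_norm (- nu1 - nu2)).
have e : inv_norm (- nu1 - nu2) *: - nu1 + inv_norm (- nu1 - nu2) *: - nu2 =
    nrm (- nu1 - nu2) by rewrite -scalerDr.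
split; rewrite ?(ltW i0) //.
- by rewrite polar_gaussE; exists x1 => //; apply/exterior_normalP; rewrite ?opprK.
- by rewrite polar_gaussE; exists x2 => //; apply/exterior_normalP; rewrite ?opprK.
rewrite e; split; first exact: dot_nrm.
by move=> k /neg; rewrite dotZr pmulr_rlt0.
Qed.

Lemma closed_body_polar : closed (body_polar K).
Proof.
move=> y cl; apply/body_polarP.
split; first by apply: closed_sphere; apply: closure_subset cl => z [].
move=> m Mm; have clm : closed [set z : 'rV[R]_n.+2 | dot z m <= 0].
  rewrite (_ : [set z | _] = (fun z : 'rV[R]_n.+2 =>
    dot z m) @^-1` [set r | r <= 0]) //.
  apply: closed_comp => [z _|]; last exact: closed_le.
  exact: dot_continuous.
have : closure [set z : 'rV[R]_n.+2 | dot z m <= 0] y.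
  by apply: closure_subset cl => z /body_polarP[_ /(_ m Mm)]; rewrite /= dotC.
by move=> /clm /=; rewrite dotC.
Qed.

(** If no point of M is orthogonal to y, then y is interior by [near_strict_polar]. Conversely,
    moving y towards a contact point x makes <x, .> positive and leaves the polar. *)
Lemma body_polar_boundary : sphere_boundary (body_polar K) = polar M.
Proof.
rewrite eqEsubset; split=> y.
  move=> by_; have Py : body_polar K y by case: by_ => + _; exact: closed_body_polar.
  have [y1 My] := (body_polarP y).1 Py.
  apply/polar_witness => //; split=> //; apply: contrapT => no.
  have [|_] := near_polar_notin_boundary y1; last by apply.
  move=> m Mm; rewrite lt_neqAle My // andbT; apply/eqP => my.
  by apply: no; exists m.
move=> py; have y1 : sphere R n y by case: py.
have [le0 [x Mx xy]] := (polar_witness y1).1 py.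
have y0 := unit_neq0 y1; have x1 : dot x x = 1 by exact: MS.
split; first by apply: subset_closure; apply/body_polarP.
move=> B nB.
have : \forall t \near (0 : R), B (nrm (y + t *: x)).
  have : \forall z \near y, B (nrm z).
    have : nbhs (nrm y) B by rewrite nrm_id.
    exact: (nrm_continuous y0).
  exact: near0_line.
move=> h; have [|t t0 Bt] := @near_pos _ (fun t => B (nrm (y + t *: x))).
  by apply: filterS h.
have pos : 0 < dot x (y + t *: x) by rewrite dotDr dotZr xy x1 mulr1 add0r.
have z0 : y + t *: x != 0 by apply: contraTneq pos => ->; rewrite dot0r ltxx.
exists (nrm (y + t *: x)); split=> //; split; first exact: dot_nrm.
move=> /body_polarP[_ /(_ x Mx)]; rewrite dotZr pmulr_rle0 ?inv_norm_gt0 //.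
by rewrite leNgt pos.
Qed.

Lemma body_polar_is_convex : is_convex_body (body_polar K).
Proof.
split.
- by move=> y [].
- exact: closed_body_polar.
- move=> x y s t /body_polarP[_ Mx] /body_polarP[_ My] s0 t0 st1.
  apply/body_polarP; split=> // m Mm; rewrite dotDr !dotZr.
  have := mulr_ge0_le0 s0 (Mx m Mm); have := mulr_ge0_le0 t0 (My m Mm); lra.
have [y1 [y2 [s [_ _ _ [S1 neg]]]]] := body_polar_interior.
by exists (s *: y1 + s *: y2); exact: near_polar_notin_boundary.
Qed.

Lemma body_polarE : body_polar (convex_body M) = convex_body (gauss_image M).
Proof.
rewrite convex_bodyE -polar_gaussE.
have [y1 [y2 [s [py1 py2 s0 [S1 neg]]]]] := body_polar_interior.
have [P1 nb] := near_polar_notin_boundary S1 neg.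
rewrite body_polar_boundary in nb.
by rewrite (convex_body_eq body_polar_is_convex body_polar_boundary py1 py2 s0 s0 P1 nb).
Qed.

End StrictlyConvexBody.

Theorem theorem2p8 (R : realType) (n : nat) (M : set 'rV[R]_n.+2)
    (n_gt0 : (0 < n)%N)
    (M_hyp : is_hypersurface M) (M_nonempty : M !=set0)
    (M_closed : compact M) (M_connected : connected M)
    (M_convex : strictly_convex M) :
  polar M = gauss_image M /\
  body_polar (convex_body M) = convex_body (gauss_image M).
Proof.
have [p Mp cvx] := M_convex; split.
  exact: (polar_gaussE n_gt0 M_hyp M_nonempty M_closed Mp cvx).
exact: (body_polarE n_gt0 M_hyp M_nonempty M_closed Mp cvx).
Qed.
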